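(* Let $\mathcal{H},\mathcal{K}$ be Hilbert spaces, let $\Phi_1,\ldots,\Phi_n:\mathcal{B}(\mathcal{H})\to\mathcal{B}(\mathcal{K})$ be positive linear mappings with $\sum_{i=1}^n\Phi_i(\mathbf{1}_{\mathcal{H}})=\mathbf{1}_{\mathcal{K}}$, and let $A_1,\ldots,A_n\in\mathcal{B}(\mathcal{H})$ be self-adjoint operators with spectra contained in the interval $J$. If $f\in C^1_{\mathrm{co}}(J)$, then $$f\left(\sum_{i=1}^n\Phi_i(A_i)\right)\le\sum_{i=1}^n\Phi_i(f(A_i))+\eta\,\mathbf{1}_{\mathcal{K}},$$ where $$\eta=\sup_{x\in\mathcal{K},\ \|x\|=1}\left\{\left\langle f'\left(\sum_{i=1}^n\Phi_i(A_i)\right)\sum_{i=1}^n\Phi_i(A_i)x,x\right\rangle-\left\langle\sum_{i=1}^n\Phi_i(A_i)x,x\right\rangle\left\langle f'\left(\sum_{i=1}^n\Phi_i(A_i)\right)x,x\right\rangle\right\}.$$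
   Context: $\mathcal{B}(\mathcal{H})$ is the $C^*$-algebra of bounded linear operators on a (complex) Hilbert space $\mathcal{H}$, with identity $\mathbf{1}_{\mathcal{H}}$. An operator $A$ is positive ($A\ge 0$) if $\langle Ax,x\rangle\ge 0$ for all $x\in\mathcal{H}$; for self-adjoint $A,B$, $A\le B$ means $B-A\ge 0$. A linear map $\Phi:\mathcal{B}(\mathcal{H})\to\mathcal{B}(\mathcal{K})$ is positive if $\Phi(A)\ge 0$ whenever $A\ge 0$. $C^1_{\mathrm{co}}(J)$ denotes the class of differentiable convex real functions on the interval $J\subseteq\mathbb{R}$ (one-sided derivatives at endpoints belonging to $J$); $f'$ is the derivative of $f$. For a self-adjoint operator $T$ with spectrum in $J$, $f(T)$ and $f'(T)$ are defined by the continuous functional calculus. *)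

(* Defs.v *)
From HB Require Import structures.
From mathcomp Require Import all_boot all_order all_algebra.
From mathcomp Require Import complex.
From mathcomp Require Import all_classical all_reals all_analysis.

Set Implicit Arguments.
Unset Strict Implicit.
Unset Printing Implicit Defensive.
Import Order.TTheory GRing.Theory Num.Theory.
Import numFieldNormedType.Exports.
Local Open Scope classical_set_scope.
Local Open Scope complex_scope.
Local Open Scope ring_scope.

(* The form is linear in its first argument. *)
HB.mixin Record isHilbert (R : realType) H of CompleteNormedModule R[i] H := {
  inner : {dot H for Num.conj};
  innerE : forall x : H, inner x x = `|x| ^+ 2
}.

#[short(type="hilbertType")]
HB.structure Definition Hilbert (R : realType) :=
  {H of CompleteNormedModule R[i] H & isHilbert R H}.

Notation "'<< x , y >>" := (inner x y)
  (at level 0, x, y at level 99, format "''<<' x ,  y '>>'") : ring_scope.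

Section BoundedOperators.
Variables (R : realType) (H : hilbertType R).

Definition bounded_linear : {pred H -> H} := [pred f : H -> H |
  `[< linear f /\ exists M : R, forall x, `|f x| <= M%:C * `|x| >]].

Lemma bounded_linear_submod : submod_closed bounded_linear.
Proof.
split=> [|a f g /asboolP[lf [M fM]] /asboolP[lg [N gN]]]; apply/asboolP.
  split=> [b x y|]; first by rewrite scaler0 addr0.
  by exists 0 => x; rewrite normr0 mul0r.
split=> [b x y|].
  rewrite !fctE lf lg !scalerDr !scalerA mulrC -!addrA; congr (_ + _).
  by rewrite addrCA.
have /complex_realP[r ar] : `|a| \is Num.real by rewrite normr_real.
exists (r * M + N) => x; rewrite !fctE (le_trans (ler_normD _ _))//.
rewrite rmorphD rmorphM mulrDl lerD// normrZ ar -mulrA ler_wpM2l//.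
by rewrite -ar.
Qed.

HB.instance Definition _ :=
  GRing.isSubmodClosed.Build R[i] (H -> H) bounded_linear
    bounded_linear_submod.

Record bop := Bop { bop_fun :> H -> H; _ : bop_fun \in bounded_linear }.
HB.instance Definition _ := [isSub of bop for bop_fun].
HB.instance Definition _ := [Choice of bop by <:].
HB.instance Definition _ := [SubChoice_isSubLmodule of bop by <:].

Lemma bopP (A : bop) :
  linear A /\ exists M : R, forall x, `|A x| <= M%:C * `|x|.
Proof. by case: A => f fP; move/asboolP: (fP). Qed.

Lemma bop1_subproof : (@id H) \in bounded_linear.
Proof. by apply/asboolP; split=> //; exists 1 => x; rewrite mul1r. Qed.

Lemma bopM_subproof (A B : bop) : A \o B \in bounded_linear.
Proof.
have [lA [M AM]] := bopP A; have [lB [N BN]] := bopP B.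
apply/asboolP; split=> [a x y|]; first by rewrite /= lB lA.
exists (`|M| * N) => x; rewrite (le_trans (AM _))// rmorphM -mulrA.
rewrite (@le_trans _ _ (`|M|%:C * `|B x|))//.
  by rewrite ler_wpM2r// lecR ler_norm.
by rewrite ler_wpM2l// lecR.
Qed.

Definition bop1 : bop := Bop bop1_subproof.
Definition bopM (A B : bop) : bop := Bop (bopM_subproof A B).

Lemma bop_ext (A B : bop) : (forall x, A x = B x) -> A = B.
Proof. by move=> AB; apply/val_inj/funext. Qed.

Lemma bopMA : associative bopM.
Proof. by move=> A B C; apply: bop_ext. Qed.
Lemma bop1M : left_id bop1 bopM.
Proof. by move=> A; apply: bop_ext. Qed.
Lemma bopM1 : right_id bop1 bopM.
Proof. by move=> A; apply: bop_ext. Qed.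
Lemma bopMDl : left_distributive bopM +%R.
Proof. by move=> A B C; apply: bop_ext. Qed.
Lemma bopMDr : right_distributive bopM +%R.
Proof.
move=> A B C; apply: bop_ext => x; have [lA _] := bopP A.
by have := lA 1 (B x) (C x); rewrite !scale1r.
Qed.

HB.instance Definition _ :=
  GRing.Zmodule_isPzRing.Build bop bopMA bop1M bopM1 bopMDl bopMDr.

Definition selfadjoint (A : bop) := forall x y, '<<A x, y>> = '<<x, A y>>.

(* In the order of R[i], 0 <= z says that z is real and nonnegative. *)
Definition positive (A : bop) := forall x, 0 <= '<<A x, x>>.

Definition bop_le (A B : bop) := positive (B - A).

Definition bop_norm (A : bop) : R :=
  inf [set M : R | 0 <= M /\ forall x, `|A x| <= M%:C * `|x|].

Definition invertible (A : bop) := exists B : bop, B * A = 1 /\ A * B = 1.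

Definition spectrum (A : bop) : set R[i] :=
  [set z | ~ invertible (A - z *: (1 : bop))].

Definition bop_horner (p : {poly R}) (A : bop) : bop :=
  \sum_(k < size p) (p`_k)%:C *: A ^+ k.

(* [is_cfc A f B]: B is the norm limit of p_k(A) for some real polynomials p_k
   converging to f uniformly on the spectrum of A.  For A self-adjoint and f
   continuous on the spectrum, exactly one B satisfies this. *)
Definition is_cfc (A : bop) (f : R -> R) (B : bop) :=
  exists p : nat -> {poly R},
    {uniform [set t : R | spectrum A t%:C], (fun k => horner (p k)) @ \oo --> f}
    /\ (fun k => bop_norm (bop_horner (p k) A - B)) @ \oo --> (0 : R).

Definition cfc (f : R -> R) (A : bop) : bop := xget 0 (is_cfc A f).

End BoundedOperators.

Definition positive_map (R : realType) (H K : hilbertType R)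
  (Phi : bop H -> bop K) := forall A, positive A -> positive (Phi A).

(* Derivative within the interval J, hence one-sided at its endpoints. *)
Definition diff_quotient (R : realType) (f : R -> R) (x y : R) : R :=
  (f y - f x) / (y - x).

Definition derive_in (R : realType) (J : interval R) (f : R -> R) (x : R) : R :=
  lim (diff_quotient f x @ within [set` J] x^').

Definition derivable_in (R : realType) (J : interval R) (f : R -> R) (x : R) :=
  cvg (diff_quotient f x @ within [set` J] x^').

Definition C1co (R : realType) (J : interval R) (f : R -> R) :=
  {in J, forall x, derivable_in J f x} /\
  convex_function ([set` J] : set R^o) f.

(* Main.v *)
(* For a unit vector u put s = <Su, u>, which lies in J because S inherits the
   form bounds min sp(A_i) <= S <= max sp(A_i).  The tangent line of f at s,
   f(t) >= f(s) + f'(s)(t - s), applied to the A_i and pushed through the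
   positive unital family gives <(sum Phi_i(f(A_i)))u, u> >= f(s).  The tangent
   lines at a variable base point, f(s) >= f(t) + f'(t)(s - t), applied to
   t := S give f(s) >= <f(S)u, u> + s <f'(S)u, u> - <f'(S)Su, u>.  Subtracting
   the two is the claim.
   The functional calculus rests on two facts: p >= 0 on the spectrum of a
   self-adjoint A implies p(A) >= 0, since the infimum of the numerical range
   of p(A) is a spectral value and p(A) - m is a product of factors A - w; and
   Weierstrass approximation, which applies because the derivative of a
   differentiable convex function is continuous. *)
From HB Require Import structures.
Require Import Defs.
From mathcomp Require Import all_boot all_order all_algebra.
From mathcomp Require Import complex ring lra.
From mathcomp Require Import all_classical all_reals all_analysis.
Import Order.TTheory GRing.Theory Num.Theory.
Import numFieldNormedType.Exports.
Local Open Scope classical_set_scope.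
Local Open Scope complex_scope.
Local Open Scope ring_scope.

Set Implicit Arguments.
Unset Strict Implicit.
Unset Printing Implicit Defensive.

(** * Bounded operators on a Hilbert space *)

Lemma ReD (R : rcfType) (x y : R[i]) :
  complex.Re (x + y) = complex.Re x + complex.Re y.
Proof. by case: x; case: y. Qed.

Lemma ReB (R : rcfType) (x y : R[i]) :
  complex.Re (x - y) = complex.Re x - complex.Re y.
Proof. by case: x; case: y. Qed.

Lemma ReZ (R : rcfType) (a : R) (x : R[i]) :
  complex.Re (a%:C * x) = a * complex.Re x.
Proof. by case: x => b c /=; rewrite mul0r subr0. Qed.

Section RealInnerProduct.
Variables (R : realType) (H : hilbertType R).
Implicit Types (x y z : H) (a : R).

(** The real part of the form turns estimates into inequalities in the real field, within reach of
    [lra] and [nra]; [inner_ripE] recovers the complex form. *)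
Definition rip x y : R := complex.Re '<<x, y>>.

Lemma innerxx x : '<<x, x>> = (rip x x)%:C.
Proof. by rewrite /rip RRe_real// innerE realX// normr_real. Qed.

Lemma ripC x y : rip x y = rip y x.
Proof.
rewrite /rip (hermC (inner : {dot H for Num.conj}) x y)/= expr0 mul1r.
by case: '<<y, x>>.
Qed.

Lemma ripDl x y z : rip (x + y) z = rip x z + rip y z.
Proof. by rewrite /rip linearDl/= ReD. Qed.

Lemma ripZl a x y : rip (a%:C *: x) y = a * rip x y.
Proof. by rewrite /rip linearZl_LR/= ReZ. Qed.

Lemma ripDr x y z : rip x (y + z) = rip x y + rip x z.
Proof. by rewrite ripC ripDl !(ripC x). Qed.

Lemma ripZr a x y : rip x (a%:C *: y) = a * rip x y.
Proof. by rewrite ripC ripZl (ripC x). Qed.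

Lemma ripNl x y : rip (- x) y = - rip x y.
Proof. by rewrite -[- x]scaleN1r -(rmorphN1 (real_complex R)) ripZl mulN1r. Qed.

Lemma ripNr x y : rip x (- y) = - rip x y.
Proof. by rewrite ripC ripNl ripC. Qed.

Lemma rip0l x : rip 0 x = 0.
Proof. by rewrite -[0 in LHS](subrr x) ripDl ripNl subrr. Qed.

Lemma ripxx_ge0 x : 0 <= rip x x.
Proof. by rewrite -lecR -innerxx innerE exprn_ge0. Qed.

Lemma norm_rip x : `|x| = (Num.sqrt (rip x x))%:C.
Proof.
apply/eqP; rewrite -(@eqrXn2 _ 2)//; last by rewrite lecR sqrtr_ge0.
by rewrite -innerE innerxx -rmorphXn/= sqr_sqrtr// ripxx_ge0.
Qed.

Lemma le_norm_rip (c : R) x y : 0 <= c ->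
  (`|x| <= c%:C * `|y|) = (rip x x <= c ^+ 2 * rip y y).
Proof.
move=> c0; rewrite !norm_rip -rmorphM lecR -{1}(ger0_norm c0) -sqrtr_sqr.
rewrite -sqrtrM ?sqr_ge0// ler_sqrt//.
by rewrite mulr_ge0 ?sqr_ge0 ?ripxx_ge0.
Qed.

Lemma rip_eq0 x : rip x x = 0 -> x = 0.
Proof. by move=> x0; apply/eqP; rewrite -normr_eq0 norm_rip x0 sqrtr0. Qed.

(** The form is conjugate-linear in its second argument, so a factor ['i] there rotates the
    imaginary part into the real one. *)
Lemma inner_ripE x y : '<<x, y>> = rip x y +i* rip x ('i *: y).
Proof.
rewrite /rip linearZr_LR/=; case: '<<x, y>> => a b /=.
by rewrite !(mul0r,oppr0,subr0,sub0r,mulN1r, opprK, mul1r, addr0, mulNr).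
Qed.

End RealInnerProduct.

Section BoundedOperatorTheory.
Variables (R : realType) (H : hilbertType R).
Implicit Types (x y z : H) (a b c m M : R) (A B C : bop H).

HB.instance Definition _ A := GRing.isLinear.Build _ _ _ _ A (bopP A).1.

Lemma bopD A B x : (A + B) x = A x + B x. Proof. by []. Qed.

Lemma bopN A x : (- A) x = - A x. Proof. by []. Qed.

Lemma bopZ k A x : (k *: A) x = k *: A x. Proof. by []. Qed.

Lemma bop_mul A B x : (A * B) x = A (B x). Proof. by []. Qed.

Lemma bop_one x : (1 : bop H) x = x. Proof. by []. Qed.

Lemma bopB A B x : (A - B) x = A x - B x. Proof. by []. Qed.

Definition bopE := (bopB, bopD, bopN, bopZ, bop_mul, bop_one).

Lemma bop_subr A x y : A (x - y) = A x - A y. Proof. exact: linearB. Qed.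

Lemma bopZMl k A B : (k *: A) * B = k *: (A * B).
Proof. exact: bop_ext. Qed.

Lemma bopZMr k A B : A * (k *: B) = k *: (A * B).
Proof. by apply: bop_ext => x; rewrite !bopE linearZ. Qed.

Lemma bopZR a A x y : rip ((a%:C *: A) x) y = a * rip (A x) y.
Proof. by rewrite bopZ ripZl. Qed.

Lemma selfadjointP A :
  selfadjoint A <-> forall x y, rip (A x) y = rip x (A y).
Proof.
split=> [sA x y|sA x y]; first by rewrite /rip sA.
by rewrite !inner_ripE !sA linearZ.
Qed.

Lemma selfadjoint1 : selfadjoint (1 : bop H).
Proof. by move=> x y. Qed.

Lemma selfadjoint0 : selfadjoint (0 : bop H).
Proof. by apply/selfadjointP => x y /=; rewrite rip0l ripC rip0l. Qed.

Lemma selfadjointD A B : selfadjoint A -> selfadjoint B -> selfadjoint (A + B).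
Proof.
move=> /selfadjointP sA /selfadjointP sB; apply/selfadjointP => x y.
by rewrite !bopD ripDl ripDr sA sB.
Qed.

Lemma selfadjointN A : selfadjoint A -> selfadjoint (- A).
Proof.
move=> /selfadjointP sA; apply/selfadjointP => x y.
by rewrite !bopN ripNl ripNr sA.
Qed.

Lemma selfadjointB A B : selfadjoint A -> selfadjoint B -> selfadjoint (A - B).
Proof. by move=> sA sB; apply/selfadjointD/selfadjointN. Qed.

Lemma selfadjointZ a A : selfadjoint A -> selfadjoint (a%:C *: A).
Proof.
move=> /selfadjointP sA; apply/selfadjointP => x y.
by rewrite !bopZ ripZl ripZr sA.
Qed.

Lemma selfadjointX A k : selfadjoint A -> selfadjoint (A ^+ k).
Proof.
move=> sA; elim: k => [|k IH]; first exact: selfadjoint1.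
by move=> x y; rewrite [in LHS]exprS bop_mul sA IH -bop_mul -exprSr.
Qed.

Lemma selfadjoint_sum (I : Type) (r : seq I) (F : I -> bop H) :
  (forall i, selfadjoint (F i)) -> selfadjoint (\sum_(i <- r) F i).
Proof.
move=> sF; apply: big_rec => [|i A _ sA]; last exact: selfadjointD.
exact: selfadjoint0.

Qed.

(** Complex polarization: <Az, z> is real for every z, and expanding its vanishing imaginary part at
    z = x + iy leaves [rip (A y) x = rip (A x) y]. *)
Lemma positive_selfadjoint A : positive A -> selfadjoint A.
Proof.
move=> pA; have im0 x : rip (A x) ('i *: x) = 0.
  by have := pA x; rewrite lecE inner_ripE/= => /andP[/eqP].
apply/selfadjointP => x y.
have := im0 (x + 'i *: y).
have := im0 y; have := im0 x.
have iiN z : 'i *: ('i *: z) = - z by rewrite scalerA -expr2 sqr_i scaleN1r.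
rewrite scalerDr iiN !linearD !linearZ/= !(ripDl, ripDr, ripNr).
have iZ (u v : H) : rip ('i *: u) ('i *: v) = rip u v.
  rewrite /rip linearZl_LR linearZr_LR/=; case: '<<u, v>> => p q /=.
  by rewrite !(mul0r,oppr0,subr0,sub0r,mulN1r, opprK, mul1r, addr0, mulNr, add0r).
have iA : rip ('i *: A y) y = - rip (A y) ('i *: y).
  by rewrite -(iZ _ y) iiN ripNl.
rewrite iZ iA => xx yy h.
have {h} e : rip (A y) x = rip (A x) y by lra.
by rewrite -e ripC.
Qed.

Lemma selfadjoint_inner A x : selfadjoint A -> '<<A x, x>> = (rip (A x) x)%:C.
Proof.
move=> sA; apply/eqP; rewrite eq_complex eqxx/=; apply/eqP.
have : '<<A x, x>> = ('<<A x, x>>)^*%C.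
  rewrite {1}sA (hermC (inner : {dot H for Num.conj}))/= expr0 mul1r.
  by case: '<<A x, x>>.
by case: '<<A x, x>> => p q [] /= q0; lra.
Qed.

Lemma positiveP A :
  positive A <-> selfadjoint A /\ forall x, 0 <= rip (A x) x.
Proof.
split=> [pA|[sA pA] x]; last by rewrite selfadjoint_inner// ler0c.
split; first exact: positive_selfadjoint.
by move=> x; have := pA x; rewrite lecE => /andP[].
Qed.

Lemma positiveD A B : positive A -> positive B -> positive (A + B).
Proof.
by move=> pA pB x; rewrite bopD linearDl/= addr_ge0.
Qed.

Lemma positive_sum (I : Type) (r : seq I) (F : I -> bop H) :
  (forall i, positive (F i)) -> positive (\sum_(i <- r) F i).
Proof.
move=> pF; apply: (big_ind (@positive R H)) => //; last exact: positiveD.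
by apply/positiveP; split=> [|x]; [exact: selfadjoint0|rewrite rip0l].
Qed.

(* Expand 0 <= <C y, y> at y = x - Cx/M. *)
Lemma positive_norm_le C M x : selfadjoint C ->
  (forall x, 0 <= rip (C x) x <= M * rip x x) -> 0 < M ->
  rip (C x) (C x) <= M * rip (C x) x.
Proof.
move=> /selfadjointP sC CM M0.
have /andP[+ _] := CM (x - (M^-1)%:C *: C x).
have /andP[_] := CM (C x).
rewrite linearB linearZ/= !(ripDl, ripDr, ripNl, ripNr, ripZl, ripZr).
rewrite (sC (C x) x).
set p := rip (C (C x)) _; set q := rip (C x) (C x); set r := rip (C x) x.
move=> pq h.
have e : M * M^-1 = 1 by rewrite divff// gt_eqF.
have h1 : 0 <= M ^+ 2 * (r - M^-1 * q + (- (M^-1 * q) + M^-1 * (M^-1 * p))).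
  rewrite mulr_ge0 ?sqr_ge0//; lra.
have e1 : M ^+ 2 * (r - M^-1 * q + (- (M^-1 * q) + M^-1 * (M^-1 * p))) =
  M^+2 * r - (M * M^-1) * M * q *+2 + (M * M^-1)^+2 * p by ring.
move: h1; rewrite e1 e => h1.
have : 0 <= M * (M * r - q) by rewrite mulrBr; nra.
by rewrite pmulr_rge0// subr_ge0.
Qed.

(** Shifting by c turns the two-sided bound into 0 <= B + c <= 2c, where [positive_norm_le] applies;
    the cross terms cancel. This is how form bounds become norm bounds below. *)
Lemma selfadjoint_norm_le B c x : selfadjoint B -> 0 < c ->
  (forall x, - c * rip x x <= rip (B x) x <= c * rip x x) ->
  rip (B x) (B x) <= c ^+ 2 * rip x x.
Proof.
move=> sB c0 Bc.
have sBc : selfadjoint (B + c%:C *: (1 : bop H)).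
  by apply/selfadjointD/selfadjointZ/selfadjoint1.
have := @positive_norm_le _ (2 * c) x sBc; rewrite !bopE.
rewrite !(ripDl, ripDr, ripZl, ripZr) (ripC x (B x)).
set p := rip (B x) (B x) => h.
suff : p + c * rip (B x) x + (c * rip (B x) x + c * (c * rip x x)) <=
   2 * c * (rip (B x) x + c * rip x x) by nra.
apply: h; last lra.
move=> y; have /andP[] := Bc y; rewrite !bopE ripDl ripZl.
by move=> *; apply/andP; split; nra.
Qed.

(** The form bounds follow from the norm bound through |Ax + Mx|^2 >= 0 and |Ax - Mx|^2 >= 0. Adding
    1 to the given bound makes M strictly positive, so that it can be cancelled. *)
Lemma bop_form_bound A : exists2 M, 0 < M & forall x,
  rip (A x) (A x) <= M ^+ 2 * rip x x /\
  - M * rip x x <= rip (A x) x <= M * rip x x.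
Proof.
have [_ [M0 AM0]] := bopP A; pose M := `|M0| + 1.
have M_gt0 : 0 < M by rewrite ltr_wpDl.
have AM x : rip (A x) (A x) <= M ^+ 2 * rip x x.
  rewrite -(le_norm_rip (A x) x (ltW M_gt0)) (le_trans (AM0 x))// ler_wpM2r// lecR.
  by rewrite (le_trans (ler_norm _))// lerDl.
exists M => // x; split=> //.
have := ripxx_ge0 (A x - M%:C *: x); have := ripxx_ge0 (A x + M%:C *: x).
rewrite !(ripDl, ripDr, ripNl, ripNr, ripZl, ripZr) (ripC x (A x)).
have := AM x; set p := rip (A x) (A x); set q := rip (A x) x => h h1 h2.
have : 0 <= M * (M * rip x x - q) by nra.
have : 0 <= M * (M * rip x x + q) by nra.
rewrite !pmulr_rge0// => *; apply/andP; split; lra.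
Qed.

End BoundedOperatorTheory.

(** * Limits of vectors and operators with an explicit rate *)

Section Completeness.
Variables (R : realType) (H : hilbertType R).
Implicit Types (x y z : H) (A B C : bop H).

Lemma cvg0_ex (e : nat -> R) (r : R) : e @ \oo --> (0 : R) -> 0 < r ->
  exists N, forall k, (N <= k)%N -> `|e k| < r.
Proof. by move=> /cvgr0Pnorm_lt e0 /e0[N _ eN]; exists N. Qed.

Lemma le0_cvg0 (e : nat -> R) (c r : R) :
  e @ \oo --> (0 : R) -> (forall k, r <= e k * c) -> r <= 0.
Proof.
move=> e0 re; rewrite leNgt; apply/negP => r0.
have c0 : 0 < `|c| + 1 by rewrite ltr_wpDl.
have [N /(_ N (leqnn N)) eN] := cvg0_ex e0 (divr_gt0 r0 c0).
have := re N; rewrite leNgt => /negP; apply.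
rewrite (le_lt_trans (ler_norm _))// normrM.
rewrite (@le_lt_trans _ _ (`|e N| * (`|c| + 1)))//.
  by rewrite ler_wpM2l// lerDl.
by rewrite -ltr_pdivlMr.
Qed.

Lemma normC_Re x : `|x| = (complex.Re `|x|)%:C.
Proof. by rewrite RRe_real// normr_real. Qed.

Lemma norm_cvg0_eq0 (e : nat -> R) (c : R) x : e @ \oo --> (0 : R) ->
  (forall k, `|x| <= (e k * c)%:C) -> x = 0.
Proof.
move=> e0 xe; apply/eqP; rewrite -normr_le0 normC_Re.
rewrite (lecR _ 0); apply: (le0_cvg0 (c := c) e0) => k.
by rewrite -lecR -normC_Re.
Qed.

(** The Cauchy rate e passes to the limit by sending the later index to infinity, which keeps the
    estimates below explicit. *)
Lemma hilbert_complete (u : nat -> H) (e : nat -> R) :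
  (forall k l, (k <= l)%N -> `|u l - u k| <= (e k)%:C) ->
  e @ \oo --> (0 : R) -> exists l, forall k, `|u k - l| <= (e k)%:C.
Proof.
move=> ue e0.
have : cvg (u @ \oo).
  apply/cauchy_cvgP/cauchy_exP => eps eps0.
  have epsE : eps = (complex.Re eps)%:C by rewrite RRe_real// gtr0_real.
  have re0 : 0 < complex.Re eps by rewrite -ltcR -epsE.
  have [N /(_ N (leqnn N)) eN] := cvg0_ex e0 re0.
  exists (u N); exists N => // l /= Nl.
  rewrite -ball_normE/= distrC (le_lt_trans (ue N l _))//.
  by rewrite epsE ltcR (le_lt_trans _ eN)// ler_norm.
case/cvg_ex => /= l ul; exists l => k.
rewrite normC_Re lecR; apply/ler_addgt0Pr => eps eps0.
have eps0C : 0 < eps%:C by rewrite ltcR.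
have [N _ ulN] := (@cvgr_dist_lt _ _ _ _ _ _ _ ul) _ eps0C.
have := ulN (maxn N k) (leq_maxl _ _) => /= /ltW ulm.
rewrite -lecR -normC_Re rmorphD/=.
rewrite -(subrKA (u (maxn N k))) (le_trans (ler_normD _ _))// lerD//.
  by rewrite distrC ue// leq_maxr.
by rewrite distrC.
Qed.

(** The limit is built pointwise, by completeness of H and choice; the uniform rate then yields
    linearity, and boundedness by comparison with [T 0]. *)
Lemma bop_complete (T : nat -> bop H) (e : nat -> R) :
  (forall k l x, (k <= l)%N -> `|T l x - T k x| <= (e k)%:C * `|x|) ->
  e @ \oo --> (0 : R) ->
  exists B, forall k x, `|T k x - B x| <= (e k)%:C * `|x|.
Proof.
move=> Te e0.
have e_cvg x : (fun k => e k * complex.Re `|x|) @ \oo --> (0 : R).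
  by rewrite -[X in _ --> X](mul0r (complex.Re `|x|)); apply: cvgMl.
have /choice[B BT] : forall x, exists l, forall k,
    `|T k x - l| <= (e k)%:C * `|x|.
  move=> x; have [k l kl|l lT] := hilbert_complete (u := T ^~ x) _ (e_cvg x).
    by rewrite rmorphM/= -normC_Re Te.
  by exists l => k; rewrite (le_trans (lT k))// rmorphM/= -normC_Re.
have Blin : linear B.
  move=> a x y; apply/eqP; rewrite -subr_eq0; apply/eqP.
  (* The defect of linearity of B is the sum of three approximation errors of [T k]; c collects
     their weights. *)
  pose c := complex.Re `|a *: x + y| + complex.Re (`|a| * `|x|) +
            complex.Re `|y|.
  apply: (norm_cvg0_eq0 (c := c) e0) => k.
  have -> : B (a *: x + y) - (a *: B x + B y) =
      - (T k (a *: x + y) - B (a *: x + y)) + a *: (T k x - B x) +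
      (T k y - B y).
    rewrite [T k (_ + _)]linearP scalerBr opprB -(addrA (B _ - _)) (addrACA (_ *: _)).
    by rewrite -(opprD (_ *: B x)) subrKA.
  rewrite rmorphM !rmorphD/= -!normC_Re RRe_real; last first.
    by rewrite rpredM// normr_real.
  rewrite !mulrDr (le_trans (ler_normD _ _))// lerD//.
  rewrite (le_trans (ler_normD _ _))// lerD// ?normrN//.
  by rewrite normrZ mulrCA ler_wpM2l.
have Bbd : B \in @bounded_linear R H.
  apply/asboolP; split=> //; have [_ [M TM]] := bopP (T 0).
  exists (M + e 0) => x; rewrite rmorphD mulrDl/=.
  rewrite -[B x](subrK (T 0 x)) addrC (le_trans (ler_normD _ _))// lerD//.
  by rewrite distrC.
by exists (Bop Bbd).
Qed.

End Completeness.

(** * Neumann series and coercive operators *)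

Section Invertibility.
Variables (R : realType) (H : hilbertType R).
Implicit Types (x y z : H) (a b c m M : R) (A B C T : bop H).

Lemma invertibleM A B : invertible A -> invertible B -> invertible (A * B).
Proof.
move=> [A' [A'A AA']] [B' [B'B BB']]; exists (B' * A'); split.
  by rewrite mulrA -(mulrA B') A'A mulr1.
by rewrite mulrA -(mulrA A) BB' mulr1.
Qed.

Lemma invertible1 : invertible (1 : bop H).
Proof. by exists 1; rewrite mulr1. Qed.

Lemma invertibleZ (k : R[i]) A : k != 0 -> invertible A -> invertible (k *: A).
Proof.
move=> k0 [B [BA AB]]; exists (k^-1 *: B).
by rewrite !bopZMl !bopZMr !scalerA BA AB mulVf// mulfV// scale1r.
Qed.

Lemma invertibleN A : invertible (- A) -> invertible A.
Proof. by move=> [B [BA AB]]; exists (- B); rewrite mulrN mulNr -mulrN -mulNr. Qed.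

(** If D inverts AB = BA, then BD is a right inverse of A and DB a left inverse, so the two
    coincide. *)
Lemma invertible_comm A B : A * B = B * A -> invertible (A * B) -> invertible A.
Proof.
move=> AB [D [DAB ABD]]; exists (B * D); split; last by rewrite mulrA.
have DBA : D * B * A = 1 by rewrite -mulrA -AB.
by rewrite -[B * D]mul1r -{1}DBA -(mulrA (D * B)) (mulrA A) ABD mulr1 DBA.
Qed.

Lemma normX_le T (q : R) k x : 0 <= q ->
  (forall x, `|T x| <= q%:C * `|x|) -> `|(T ^+ k) x| <= (q ^+ k)%:C * `|x|.
Proof.
move=> q0 Tq; elim: k => [|k IH]; first by rewrite !expr0 mul1r.
rewrite !exprS bop_mul (le_trans (Tq _))// rmorphM/= -mulrA ler_wpM2l//.
by rewrite lecR.
Qed.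

Lemma neumann T (q : R) : 0 <= q < 1 ->
  (forall x, `|T x| <= q%:C * `|x|) -> invertible (1 - T).
Proof.
move=> /andP[q0 q1] Tq; pose P k := \sum_(j < k) T ^+ j.
have q1' : 1 - q != 0 by rewrite subr_eq0 gt_eqF.
(* The tail of the geometric series, which bounds [P l - P k] for all l >= k. *)
pose e k := q ^+ k / (1 - q).
have e0 : e @ \oo --> (0 : R).
  rewrite -[X in _ --> X](mul0r (1 - q)^-1); apply: cvgMl.
  by apply: cvg_expr; rewrite ger0_norm.
have TX k x : `|(T ^+ k) x| <= (e k * (1 - q))%:C * `|x|.
  by rewrite /e divfK// normX_le.
have PS k : P k.+1 = P k + T ^+ k by rewrite /P big_ord_recr.
have Pe k d x : `|P (k + d)%N x - P k x| <=
    ((q ^+ k - q ^+ (k + d)) / (1 - q))%:C * `|x|.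
  elim: d => [|d IH]; first by rewrite addn0 !subrr normr0 mul0r rmorph0 mul0r.
  rewrite addnS PS bopD addrAC (le_trans (ler_normD _ _))//.
  rewrite (le_trans (lerD IH (normX_le (k + d) x q0 Tq)))//.
  rewrite -mulrDl -rmorphD ler_wpM2r// lecR le_eqVlt; apply/orP; left.
  by apply/eqP; rewrite exprS; field.
have [k l x kl|B BP] := bop_complete (T := P) (e := e) _ e0.
  rewrite -(subnKC kl) (le_trans (Pe _ _ _))// ler_wpM2r// lecR.
  by rewrite ler_wpM2r ?invr_ge0 ?subr_ge0 ?(ltW q1)// gerBl exprn_ge0.
have PT k : P k * (1 - T) = 1 - T ^+ k.
  rewrite /P; elim: k => [|k IH]; first by rewrite big_ord0 mul0r expr0 subrr.
  by rewrite big_ord_recr/= mulrDl IH mulrBr mulr1 -exprSr addrA subrK.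
have TP k : (1 - T) * P k = 1 - T ^+ k.
  rewrite /P; elim: k => [|k IH]; first by rewrite big_ord0 mulr0 expr0 subrr.
  by rewrite big_ord_recr/= mulrDr IH mulrBl mul1r -exprS addrA subrK.
(* On either side the defect splits into the error of [P k] as an approximation of B and the
   telescoping remainder [T ^+ k]; both are multiples of [e k]. *)
exists B; split; apply: bop_ext => x; apply/eqP; rewrite -subr_eq0; apply/eqP.
  pose c := complex.Re `|(1 - T) x| + (1 - q) * complex.Re `|x|.
  apply: (norm_cvg0_eq0 (c := c) e0) => k.
  have -> : (B * (1 - T)) x - (1 : bop H) x =
      - (P k ((1 - T) x) - B ((1 - T) x)) - (T ^+ k) x.
    by rewrite -bop_mul PT opprB bopB opprB addrA addrAC addrK.
  rewrite (le_trans (ler_normB _ _))// normrN mulrDr rmorphD/= lerD//.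
    by rewrite rmorphM/= -normC_Re BP.
  by rewrite mulrA rmorphM/= -normC_Re.
pose c := (1 + q) * complex.Re `|x| + (1 - q) * complex.Re `|x|.
apply: (norm_cvg0_eq0 (c := c) e0) => k.
have -> : ((1 - T) * B) x - (1 : bop H) x =
    - (1 - T) (P k x - B x) - (T ^+ k) x.
  by rewrite bop_subr -!bop_mul TP opprB bopB opprB addrA addrAC addrK.
rewrite (le_trans (ler_normB _ _))// normrN mulrDr rmorphD/= lerD//; last first.
  by rewrite mulrA rmorphM/= -normC_Re.
rewrite (le_trans (ler_normB _ _))// mulrDl mulrDr rmorphD/=.
have eB : `|P k x - B x| <= (e k * complex.Re `|x|)%:C.
  by rewrite rmorphM/= -normC_Re BP.
rewrite mul1r lerD// (le_trans (Tq _))// mulrCA rmorphM/= ler_wpM2l//.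
by rewrite lecR.
Qed.

(** Lax-Milgram for self-adjoint operators: with N = M + c the form of 1 - B/N lies between 0 and
    M/N < 1, so its norm is at most M/N and the Neumann series inverts B/N. *)
Lemma coercive_invertible B c : selfadjoint B -> 0 < c ->
  (forall x, c * rip x x <= rip (B x) x) -> invertible B.
Proof.
move=> sB c0 Bc; have [M M0 BM] := bop_form_bound B.
pose N := M + c; have N0 : 0 < N by rewrite addr_gt0.
pose T := 1 - (N^-1)%:C *: B.
have -> : B = N%:C *: (1 - T).
  rewrite /T opprB addrCA subrr addr0 scalerA -rmorphM/= divff ?gt_eqF//.
  by rewrite scale1r.
have NcM : c / N = 1 - M / N by rewrite /N; field; rewrite gt_eqF.
have MN1 : 0 < M / N < 1.
  by rewrite divr_gt0//= ltr_pdivrMr// mul1r ltrDl.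
apply: invertibleZ; first by rewrite (inj_eq (@complexI R) N 0) gt_eqF.
apply: (@neumann _ (M / N)) => [|x].
  by case/andP: MN1 => /ltW -> ->.
have [MN0 MN2] := andP MN1.
rewrite le_norm_rip ?(ltW MN0)//.
apply: selfadjoint_norm_le => // [|y].
  by apply/selfadjointB/selfadjointZ => //; exact: selfadjoint1.
have [_ /andP[_ BMy]] := BM y; have Bcy := Bc y.
rewrite !bopE ripDl ripNl ripZl.
have : N^-1 * (c * rip y y) <= N^-1 * rip (B y) y.
  by rewrite ler_wpM2l// invr_ge0 ltW.
have : N^-1 * rip (B y) y <= N^-1 * (M * rip y y).
  by rewrite ler_wpM2l// invr_ge0 ltW.
rewrite !mulrA ![N^-1 * _]mulrC NcM => h1 h2.
have := ripxx_ge0 y => y0.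
by apply/andP; split; nra.
Qed.

End Invertibility.

(** * Spectrum and polynomial calculus *)

Section Spectrum.
Variables (R : realType) (H : hilbertType R).
Implicit Types (x y z : H) (a b c m M t : R) (A B C : bop H).

Lemma bop_mulBD A (k : R[i]) :
  (A - k *: (1 : bop H)) * (A + k *: (1 : bop H)) = A * A - k ^+ 2 *: (1 : bop H).
Proof.
rewrite mulrBl !mulrDr !bopZMr !bopZMl !mul1r !mulr1 opprD addrA addrK.
by rewrite scalerA expr2.
Qed.

Lemma bop_mulDB A (k : R[i]) :
  (A + k *: (1 : bop H)) * (A - k *: (1 : bop H)) = A * A - k ^+ 2 *: (1 : bop H).
Proof.
rewrite mulrBr !mulrDl !bopZMr !bopZMl !mul1r !mulr1 opprD addrA addrK.
by rewrite scalerA expr2.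
Qed.

(** For w = a + ib with b nonzero, A - w and A minus the conjugate of w commute, and their product
    (A - a)^2 + b^2 is coercive, hence invertible. *)
Lemma spectrum_real A (w : R[i]) : selfadjoint A -> spectrum A w ->
  w = (complex.Re w)%:C.
Proof.
case: w => a b sA /= Aw; have [->//|b0] := eqVneq b 0; exfalso; apply: Aw.
set w := a +i* b; pose C := A - a%:C *: (1 : bop H).
have sC : selfadjoint C.
  by apply: selfadjointB => //; apply/selfadjointZ/selfadjoint1.
pose D := A - (a -i* b) *: (1 : bop H).
have wE : A - w *: (1 : bop H) = C - (0 +i* b) *: (1 : bop H).
  rewrite /C -addrA -opprD -scalerDl; congr (_ - _ *: _).
  by apply/eqP; rewrite eq_complex/= addr0 add0r !eqxx.
have DE : D = C + (0 +i* b) *: (1 : bop H).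
  rewrite /D /C -addrA -!scaleNr -scalerDl; congr (_ + _ *: _).
  by apply/eqP; rewrite eq_complex/= opprK addr0 oppr0 add0r !eqxx.
have ii : C * C - (0 +i* b) ^+ 2 *: (1 : bop H) =
    C * C + (b ^+ 2)%:C *: (1 : bop H).
  rewrite -scaleNr; congr (_ + _ *: _); apply/eqP.
  by rewrite eq_complex/= !mul0r !mulr0 sub0r opprK addr0 oppr0 expr2 !eqxx.
have CC : (A - w *: (1 : bop H)) * D = C * C + (b ^+ 2)%:C *: (1 : bop H).
  by rewrite wE DE bop_mulBD ii.
have CC' : D * (A - w *: (1 : bop H)) = C * C + (b ^+ 2)%:C *: (1 : bop H).
  by rewrite wE DE bop_mulDB ii.
apply: (@invertible_comm _ _ _ D); first by rewrite CC CC'.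
rewrite CC; apply: (@coercive_invertible _ _ _ (b ^+ 2)).
- apply: selfadjointD; last exact/selfadjointZ/selfadjoint1.
  by move=> x y; rewrite !bop_mul !sC.
- by rewrite lt_def sqr_ge0 sqrf_eq0 b0.
by move=> x; rewrite bopD ripDl bopZR lerDr bop_mul (selfadjointP C).1 ?ripxx_ge0.
Qed.

(** For t < m the operator A - t is coercive with constant m - t, hence invertible. *)
Lemma le_spectrum A m t : selfadjoint A ->
  (forall x, m * rip x x <= rip (A x) x) -> spectrum A t%:C -> m <= t.
Proof.
move=> sA Am At; rewrite leNgt; apply/negP => tm; apply: At.
apply: (@coercive_invertible _ _ _ (m - t)); rewrite ?subr_gt0//.
  by apply/selfadjointB/selfadjointZ => //; exact: selfadjoint1.
move=> x; rewrite !bopE ripDl ripNl ripZl mulrBl.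
by rewrite lerD2r.
Qed.

Lemma spectrumN A w : spectrum (- A) w -> spectrum A (- w).
Proof.
move=> Aw; apply: contra_not Aw => Aw; apply: invertibleN.
by move: Aw; rewrite scaleNr opprD !opprK.
Qed.

Lemma ge_spectrum A M t : selfadjoint A ->
  (forall x, rip (A x) x <= M * rip x x) -> spectrum A t%:C -> t <= M.
Proof.
move=> sA AM At; rewrite -lerN2; apply: (le_spectrum (A := - A)).
- exact: selfadjointN.
- by move=> x; rewrite bopN ripNl mulNr lerN2.
- by rewrite rmorphN; apply: spectrumN; rewrite opprK.
Qed.

(** With C = A - m >= 0 and inverse D, |x|^2 = |DCx|^2 <= N^2 |Cx|^2 <= N^2 M <Cx, x>, so the lower
    bound improves by 1/(N^2 M). *)
Lemma invertible_form_gap A m : selfadjoint A ->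
  (forall x, m * rip x x <= rip (A x) x) ->
  invertible (A - m%:C *: (1 : bop H)) ->
  exists2 d, 0 < d & forall x, (m + d) * rip x x <= rip (A x) x.
Proof.
move=> sA Am [D [DC _]].
set C := A - _ in DC.
have sC : selfadjoint C.
  by apply/selfadjointB/selfadjointZ => //; exact: selfadjoint1.
have CE x : rip (C x) x = rip (A x) x - m * rip x x.
  by rewrite !bopE ripDl ripNl ripZl.
have [M M0 CM] := bop_form_bound C.
have [N N0 DN] := bop_form_bound D.
have NM0 : 0 < N ^+ 2 * M by rewrite mulr_gt0// exprn_gt0.
exists (N ^+ 2 * M)^-1; rewrite ?invr_gt0// => x.
rewrite mulrDl -lerBrDl -CE ler_pdivrMl//.
have -> : rip x x = rip (D (C x)) (D (C x)) by rewrite -bop_mul DC.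
rewrite (le_trans (DN (C x)).1)// -(mulrA _ M) ler_wpM2l ?sqr_ge0//.
apply: positive_norm_le => // y.
by rewrite (andP (CM y).2).2 CE subr_ge0 Am.
Qed.

(** Take m to be the infimum of the form over unit vectors. Were A - m invertible,
    [invertible_form_gap] would give a strictly larger lower bound. *)
Lemma inf_spectrum A : (exists x : H, x != 0) -> selfadjoint A ->
  exists2 m, spectrum A m%:C & forall x, m * rip x x <= rip (A x) x.
Proof.
move=> [x0 x00] sA.
pose E := [set rip (A x) x | x in [set x | rip x x = 1]].
have normalize x : x != 0 ->
    E (rip (A x) x / rip x x) /\ 0 < rip x x.
  move=> xn0; have xx0 : 0 < rip x x.
    by rewrite lt_def ripxx_ge0 andbT; apply: contra xn0 => /eqP/rip_eq0 ->.
  split=> //; exists ((Num.sqrt (rip x x))^-1%:C *: x).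
    rewrite /= ripZl ripZr mulrA -expr2 exprVn sqr_sqrtr ?ltW//.
    by rewrite mulVf// gt_eqF.
  rewrite linearZ ripZl ripZr mulrA -expr2 exprVn sqr_sqrtr ?ltW//.
  by rewrite mulrC.
have [M M0 AM] := bop_form_bound A.
have Einf : has_inf E.
  split; first by exists (rip (A x0) x0 / rip x0 x0); case: (normalize x0).
  exists (- M) => _ [x /= x1 <-]; have [_ /andP[+ _]] := AM x.
  by rewrite x1 mulr1.
have Am x : inf E * rip x x <= rip (A x) x.
  have [->|xn0] := eqVneq x 0; first by rewrite rip0l mulr0 ripC rip0l.
  have [Ex xx0] := normalize _ xn0.
  by rewrite -ler_pdivlMr//; apply: ge_inf => //; case: Einf.
exists (inf E) => //; apply: contrapT => /contrapT.
case/(invertible_form_gap sA Am) => d d0 Ad.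
have : inf E + d <= inf E.
  apply: lb_le_inf; first by case: Einf.
  by move=> _ [x /= x1 <-]; have := Ad x; rewrite x1 mulr1.
by rewrite gerDl leNgt d0.
Qed.

Lemma sup_spectrum A : (exists x : H, x != 0) -> selfadjoint A ->
  exists2 m, spectrum A m%:C & forall x, rip (A x) x <= m * rip x x.
Proof.
move=> H0 sA; have [m Am mA] := inf_spectrum H0 (selfadjointN sA).
exists (- m); first by rewrite rmorphN; exact: spectrumN.
by move=> x; have := mA x; rewrite bopN ripNl mulNr lerNr.
Qed.

End Spectrum.

Section PolynomialCalculus.
Variables (R : realType) (H : hilbertType R).
Implicit Types (A B : bop H) (p q : {poly R[i]}).

(** Complex coefficients extend [bop_horner], so that polynomials split into linear factors. *)
Definition peval p A : bop H := \sum_(k < size p) p`_k *: A ^+ k.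

Lemma peval_widen n p A : (size p <= n)%N ->
  peval p A = \sum_(k < n) p`_k *: A ^+ k.
Proof.
move=> pn; rewrite /peval (big_ord_widen n (fun k => p`_k *: A ^+ k) pn).
rewrite big_mkcond; apply: eq_bigr => k _.
by case: ltnP => // /(nth_default 0) ->; rewrite scale0r.
Qed.

Lemma pevalD p q A : peval (p + q) A = peval p A + peval q A.
Proof.
pose n := maxn (size p) (size q).
rewrite !(@peval_widen n) ?leq_maxl ?leq_maxr ?size_polyD//.
by rewrite -big_split/=; apply: eq_bigr => k _; rewrite coefD scalerDl.
Qed.

Lemma pevalZ (c : R[i]) p A : peval (c *: p) A = c *: peval p A.
Proof.
rewrite !(@peval_widen (size p)) ?size_scale_leq// scaler_sumr.
by apply: eq_bigr => k _; rewrite coefZ scalerA.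
Qed.

Lemma pevalC (c : R[i]) A : peval c%:P A = c *: (1 : bop H).
Proof.
by rewrite (@peval_widen 1) ?size_polyC_leq1// big_ord1 coefC expr0.
Qed.

Lemma peval1 A : peval 1 A = 1.
Proof. by rewrite -polyC1 pevalC scale1r. Qed.

Lemma pevalMX p A : peval (p * 'X) A = peval p A * A.
Proof.
rewrite (@peval_widen (size p).+1); last first.
  by rewrite (leq_trans (size_polyMleq _ _))// size_polyX addn2.
rewrite big_ord_recl coefMX eqxx scale0r add0r /peval mulr_suml.
by apply: eq_bigr => k _; rewrite coefMX/= bopZMl exprSr.
Qed.

Lemma pevalM p q A : peval (p * q) A = peval p A * peval q A.
Proof.
elim/poly_ind: q => [|q c IH].
  by rewrite mulr0 /peval size_poly0 !big_ord0 mulr0.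
rewrite mulrDr mulrA !pevalD !pevalMX IH -mulrA mulrDr; congr (_ + _).
by rewrite mulrC mul_polyC pevalZ pevalC bopZMr mulr1.
Qed.

Lemma pevalXsubC (w : R[i]) A : peval ('X - w%:P) A = A - w *: (1 : bop H).
Proof.
rewrite -['X]mul1r -polyCN pevalD pevalMX peval1 pevalC mul1r.
by rewrite scaleNr.
Qed.

(* Over the algebraically closed R[i], p splits and p(A) is a product of the
   invertible factors A - w. *)
Lemma peval_invertible p A : p != 0 ->
  (forall w, spectrum A w -> p.[w] != 0) -> invertible (peval p A).
Proof.
move=> p0 pA; have [r pE] := closed_field_poly_normal p.
have rA w : w \in r -> invertible (A - w *: (1 : bop H)).
  move=> wr; apply: contrapT => /pA; rewrite pE hornerZ => /negP; apply.
  have : root (\prod_(z <- r) ('X - z%:P)) w by rewrite root_prod_XsubC.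
  by rewrite rootE => /eqP ->; rewrite mulr0.
rewrite pE pevalZ; apply: invertibleZ; first by rewrite lead_coef_eq0.
elim: r rA {pE} => [|w r IH] rA; first by rewrite big_nil peval1; exact: invertible1.
rewrite big_cons pevalM pevalXsubC; apply: invertibleM.
  by apply: rA; rewrite mem_head.
by apply: IH => z zr; apply: rA; rewrite in_cons zr orbT.
Qed.

End PolynomialCalculus.

Section RealPolynomialCalculus.
Variables (R : realType) (H : hilbertType R).
Implicit Types (A B : bop H) (p q : {poly R}).

Lemma bop_hornerE p A : bop_horner p A = peval (map_poly (real_complex R) p) A.
Proof.
rewrite /bop_horner /peval size_map_poly.
by apply: eq_bigr => k _; rewrite coef_map.
Qed.

Lemma bop_hornerD p q A :
  bop_horner (p + q) A = bop_horner p A + bop_horner q A.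
Proof. by rewrite !bop_hornerE rmorphD pevalD. Qed.

Lemma bop_hornerM p q A :
  bop_horner (p * q) A = bop_horner p A * bop_horner q A.
Proof. by rewrite !bop_hornerE rmorphM pevalM. Qed.

Lemma bop_hornerC (c : R) A : bop_horner c%:P A = c%:C *: (1 : bop H).
Proof. by rewrite bop_hornerE map_polyC pevalC. Qed.

Lemma bop_hornerN p A : bop_horner (- p) A = - bop_horner p A.
Proof.
by rewrite -mulN1r -polyCN bop_hornerM bop_hornerC rmorphN scaleN1r mulN1r.
Qed.

Lemma bop_hornerB p q A :
  bop_horner (p - q) A = bop_horner p A - bop_horner q A.
Proof. by rewrite bop_hornerD bop_hornerN. Qed.

Lemma bop_hornerX A : bop_horner 'X A = A.
Proof. by rewrite bop_hornerE map_polyX -['X]mul1r pevalMX peval1 mul1r. Qed.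

Lemma selfadjoint_horner p A : selfadjoint A -> selfadjoint (bop_horner p A).
Proof.
by move=> sA; apply: selfadjoint_sum => k; exact/selfadjointZ/selfadjointX.
Qed.

(** If the least spectral value m of p(A) were negative, p - m would be positive on the spectrum of
    A, making p(A) - m invertible. *)
Lemma bop_horner_positive p A : selfadjoint A ->
  (forall t : R, spectrum A t%:C -> 0 <= p.[t]) -> positive (bop_horner p A).
Proof.
move=> sA pA; apply/positiveP; split; first exact: selfadjoint_horner.
have [H0|/forallNP H0] := pselect (exists x : H, x != 0); last first.
  move=> x; have /negP/negPn/eqP -> := H0 x.
  by rewrite linear0 rip0l.
have [m Bm mB] := inf_spectrum H0 (selfadjoint_horner p sA).
suff m0 : 0 <= m.
  by move=> x; rewrite (le_trans _ (mB x))// mulr_ge0// ripxx_ge0.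
rewrite leNgt; apply/negP => m0; apply: Bm.
(* The spectral value l witnesses that p - m is a nonzero polynomial. *)
have [l Al _] := inf_spectrum H0 sA.
have -> : bop_horner p A - m%:C *: (1 : bop H) = bop_horner (p - m%:P) A.
  by rewrite bop_hornerB bop_hornerC.
have pm t : spectrum A t%:C -> 0 < (p - m%:P).[t].
  by move=> /pA pt; rewrite hornerD hornerN hornerC subr_gt0 (lt_le_trans m0).
rewrite bop_hornerE; apply: peval_invertible.
  rewrite map_poly_eq0; apply: contraTneq (pm _ Al) => ->.
  by rewrite horner0 ltxx.
move=> w Aw; move: (Aw); rewrite (spectrum_real sA Aw) => /pm.
by rewrite horner_map -ltcR; exact: lt0r_neq0.
Qed.

End RealPolynomialCalculus.

(** * Weierstrass approximation *)

Section Weierstrass.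
Variable R : realType.
Implicit Types (f : R -> R) (g h : nat -> R) (u p : {poly R}).

(* Bernstein polynomials of [g], by the recursion of a random walk that steps
   right with probability [u]: [\sum_k 'C(n, k) u^k (1 - u)^(n - k) g k]. *)
Fixpoint bernstein u n g : {poly R} :=
  if n is n'.+1 then u * bernstein u n' (g \o succn) + (1 - u) * bernstein u n' g
  else (g 0)%:P.

Lemma bernsteinS u n g x : (bernstein u n.+1 g).[x] =
  u.[x] * (bernstein u n (g \o succn)).[x] +
  (1 - u.[x]) * (bernstein u n g).[x].
Proof. by rewrite /= !hornerE. Qed.

Lemma bernstein_le u n g h x : 0 <= u.[x] <= 1 ->
  (forall k, (k <= n)%N -> g k <= h k) ->
  (bernstein u n g).[x] <= (bernstein u n h).[x].
Proof.
move=> /andP[u0 u1]; elim: n g h => [|n IH] g h gh.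
  by rewrite !hornerE gh.
rewrite !bernsteinS lerD// ler_wpM2l ?subr_ge0// IH// => k kn.
  exact: gh.
by rewrite gh// (leq_trans kn).
Qed.

Lemma bernstein_affine u n g (c d x : R) :
  (bernstein u n (fun k => c + d * g k)).[x] = c + d * (bernstein u n g).[x].
Proof.
elim: n g => [|n IH] g; first by rewrite !hornerE.
by rewrite !bernsteinS IH (IH (g \o succn)); ring.
Qed.

(** Second moment of a binomial variable about a: variance plus squared bias. In the induction a
    step to the right replaces a by a - 1. *)
Lemma bernstein_sqr u n (a x : R) :
  (bernstein u n (fun k => (k%:R - a) ^+ 2)).[x] =
  n%:R * (u.[x] * (1 - u.[x])) + (n%:R * u.[x] - a) ^+ 2.
Proof.
elim: n a => [|n IH] a; first by rewrite /= hornerC; ring.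
rewrite bernsteinS IH.
have -> : (fun k => (k%:R - a) ^+ 2) \o succn =
    (fun k => (k%:R - (a - 1)) ^+ 2) :> (nat -> R).
  by apply/funext => k /=; rewrite -natr1; ring.
by rewrite IH -natr1; ring.
Qed.

(** Heine-Cantor through the near-covering form of compactness, with the right neighbourhoods of 0
    as the filter that supplies a common d. *)
Lemma compact_uniform_continuity f (a b e : R) : 0 < e ->
  {within `[a, b], continuous f} ->
  exists2 d : R, 0 < d & {in `[a, b] &, forall x y, `|x - y| < d ->
    `|f x - f y| < e}.
Proof.
move=> e0 /subspace_continuousP fc.
pose P (d : R) x := x \in `[a, b] -> {in `[a, b], forall y, `|x - y| < d ->
  `|f x - f y| < e}.
have [|d /= d0 dP] :=
    (compact_near_coveringP _).1 (@segment_compact R a b) _ (0^'+) P _.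
  move=> x xab.
  have e20 : 0 < e / 2 by rewrite divr_gt0.
  have /cvgrPdist_lt/(_ _ e20) := fc x xab.
  move=> /nbhs_ballP[r /= r0 rf].
  have r2 : 0 < r / 2 by rewrite divr_gt0.
  exists (ball x (r / 2), [set d | d < r / 2]).
    split=> /=; first exact: nbhsx_ballx.
    by exists (r / 2) => //= d /=; rewrite sub0r normrN => /ltr_normlW.
  move=> [y d] [/= yx dr] yab z zab yz.
  have fy : `|f x - f y| < e / 2.
    by apply: rf => //; apply: le_ball yx; lra.
  have fz : `|f x - f z| < e / 2.
    apply: rf => //; rewrite -ball_normE/= -(subrKA y).
    rewrite -ball_normE/= in yx.
    by rewrite (le_lt_trans (ler_normD _ _))//; lra.
  rewrite -(subrKA (f x)) (le_lt_trans (ler_normD _ _))// distrC; lra.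
have d20 : 0 < d / 2 by rewrite divr_gt0.
exists (d / 2) => // x y xab yab xy.
have := dP (d / 2) _ d20 x; apply => //.
by rewrite /ball/= sub0r normrN gtr0_norm//; lra.
Qed.

Theorem weierstrass f (a b e : R) : a <= b -> 0 < e ->
  {within `[a, b], continuous f} ->
  exists p, {in `[a, b], forall x, `|f x - p.[x]| <= e}.
Proof.
move=> ab e0 fc.
have [c cab fM] := EVT_max ab fc.
have [c' c'ab fm] := EVT_min ab fc.
pose C := f c - f c'.
have C0 : 0 <= C by rewrite subr_ge0 fM.
have e20 : 0 < e / 2 by rewrite divr_gt0.
have [d d0 fd] := compact_uniform_continuity e20 fc.
(* C is the oscillation of f. With this D the term [D * (y - x) ^+ 2] is at least C as soon as |y -
   x| >= d, where uniform continuity says nothing. *)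
pose D := C / d ^+ 2.
have D0 : 0 <= D by rewrite divr_ge0// sqr_ge0.
have fD : {in `[a, b] &, forall x y, `|f x - f y| <= e / 2 + D * (y - x) ^+ 2}.
  move=> x y xab yab; have [xy|xy] := ltP `|x - y| d.
    by rewrite (le_trans (ltW (fd _ _ xab yab xy)))// lerDl mulr_ge0 ?sqr_ge0.
  have Cle : `|f x - f y| <= C.
    rewrite ler_norml; have := fM _ xab; have := fM _ yab.
    by have := fm _ xab; have := fm _ yab; rewrite /C => *; apply/andP; split; lra.
  rewrite (le_trans Cle)// ler_wpDl ?(ltW e20)// /D mulrAC -mulrA ler_peMr//.
  rewrite ler_pdivlMr ?exprn_gt0// mul1r -[leRHS]real_normK ?num_real// distrC.
  by rewrite ler_pXn2r// nnegrE ltW.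
(* The variance of the random node is at most (b - a)^2 / n; this n makes D times it at most e /
   2. *)
pose n := (Num.truncn (D * (b - a) ^+ 2 / (e / 2))).+1.
have n0 : 0 < n%:R :> R by rewrite ltr0n.
have nD : D * (b - a) ^+ 2 / n%:R <= e / 2.
  rewrite ler_pdivrMr// -ler_pdivrMl//.
  by rewrite ltW// [ltLHS]mulrC truncnS_gt.
pose node k : R := a + (b - a) * (k%:R / n%:R).
(* Rescaling of [a, b] to [0, 1]. If a = b the inverse of 0 is 0, so u vanishes and x = a + (b - a)
   u(x) still holds. *)
pose u : {poly R} := (b - a)^-1 *: ('X - a%:P).
exists (bernstein u n (f \o node)) => x xab.
have /andP[ax xb] : a <= x <= b by rewrite in_itv/= in xab.
have ux : u.[x] = (x - a) / (b - a) by rewrite !hornerE mulrC.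
have xE : x = a + (b - a) * u.[x].
  rewrite ux; move: ab; rewrite le_eqVlt => /predU1P[ab|ab].
    by rewrite -ab subrr mul0r addr0; apply/le_anti; rewrite ax ab xb.
  by field; rewrite subr_eq0 gt_eqF.
have u01 : 0 <= u.[x] <= 1.
  rewrite ux divr_ge0 ?subr_ge0//=.
  move: ab; rewrite le_eqVlt => /predU1P[->|ab].
    by rewrite subrr invr0 mulr0.
  by rewrite ler_pdivrMr ?subr_gt0// mul1r lerD2r.
have nodeP k : (k <= n)%N -> node k \in `[a, b].
  move=> kn; have k01 : 0 <= (k%:R / n%:R : R) <= 1.
    by rewrite divr_ge0//= ler_pdivrMr// mul1r ler_nat.
  rewrite in_itv/= /node; case/andP: k01; set q := _ / _ => q0 q1.
  by apply/andP; split; nra.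
pose E := D * (b - a) ^+ 2 / n%:R ^+ 2.
have fE k : (k <= n)%N -> `|f x - f (node k)| <=
    e / 2 + E * (k%:R - n%:R * u.[x]) ^+ 2.
  move=> kn; rewrite (le_trans (fD _ _ xab (nodeP _ kn)))// lerD2l.
  rewrite {1}xE /node /E le_eqVlt; apply/orP; left; apply/eqP; field.
  by rewrite gt_eqF.
have En : E * (n%:R * (u.[x] * (1 - u.[x]))) <= e / 2.
  apply: le_trans nD.
  have -> : E * (n%:R * (u.[x] * (1 - u.[x]))) =
      D * (b - a) ^+ 2 / n%:R * (u.[x] * (1 - u.[x])).
    by rewrite /E; field; rewrite gt_eqF.
  rewrite ler_piMr//; first by rewrite divr_ge0// mulr_ge0// sqr_ge0.
  by case/andP: u01 => *; nra.
have := bernstein_sqr u n (n%:R * u.[x]) x.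
rewrite subrr expr0n addr0 => sq.
have up := @bernstein_le u n (f \o node) (fun k => (f x + e / 2) +
    E * (k%:R - n%:R * u.[x]) ^+ 2) x u01.
have lo := @bernstein_le u n (fun k => (f x - e / 2) +
    (- E) * (k%:R - n%:R * u.[x]) ^+ 2) (f \o node) x u01.
rewrite !bernstein_affine sq in up lo.
have {}up : (bernstein u n (f \o node)).[x] <= f x + e.
  apply: (le_trans (up _)) => [k kn /=|]; last lra.
  have := fE k kn; rewrite ler_norml => /andP[+ _]. lra.
have {}lo : f x - e <= (bernstein u n (f \o node)).[x].
  apply: (le_trans _ (lo _)) => [|k kn /=]; first lra.
  by have := fE k kn; rewrite ler_norml => /andP[_]; lra.
by rewrite ler_norml; apply/andP; split; lra.
Qed.

End Weierstrass.

(** * Continuous functional calculus *)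

Section OperatorNorm.
Variables (R : realType) (H : hilbertType R).
Implicit Types (x y : H) (A B : bop H) (e : R).

Lemma bop_norm_lt A e x : bop_norm A < e -> `|A x| <= e%:C * `|x|.
Proof.
move=> Ae; have [_ [M AM]] := bopP A.
have ne : [set M : R | 0 <= M /\ forall x, `|A x| <= M%:C * `|x|] !=set0.
  exists `|M|; split=> // z; rewrite (le_trans (AM z))// ler_wpM2r// lecR.
  exact: ler_norm.
have [c [c0 Ac] ce] := inf_lt ne Ae.
by rewrite (le_trans (Ac x))// ler_wpM2r// lecR ltW.
Qed.

Lemma bop_norm_le A e : 0 <= e -> (forall x, `|A x| <= e%:C * `|x|) ->
  0 <= bop_norm A <= e.
Proof.
move=> e0 Ae; apply/andP; split.
  by apply: lb_le_inf; [exists e | move=> M []].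
by apply: ge_inf => //; exists 0 => M [].
Qed.

(** Cauchy-Schwarz combined with the arithmetic-geometric mean inequality, read off |Ax + ey|^2 >= 0
    and |Ax - ey|^2 >= 0 without square roots. *)
Lemma rip_le_norm A e x y : 0 < e -> `|A x| <= e%:C * `|x| ->
  2 * `|rip (A x) y| <= e * (rip x x + rip y y).
Proof.
move=> e0; rewrite (le_norm_rip _ _ (ltW e0)) => Ae.
have := ripxx_ge0 (A x - e%:C *: y); have := ripxx_ge0 (A x + e%:C *: y).
rewrite !(ripDl, ripDr, ripNl, ripNr, ripZl, ripZr) (ripC y (A x)).
move: Ae; set p := rip (A x) (A x); set r := rip (A x) y => Ae h1 h2.
have : 0 <= e * (e * (rip x x + rip y y) - 2 * r) by nra.
have : 0 <= e * (e * (rip x x + rip y y) + 2 * r) by nra.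
rewrite !pmulr_rge0// => h3 h4.
by have [r0|r0] := ger0P r; lra.
Qed.

End OperatorNorm.

Lemma natSinv_cvg0 (R : realType) (c : R) :
  (fun k => c * k.+1%:R^-1) @ \oo --> (0 : R).
Proof.
rewrite -[X in _ --> X](mulr0 c); apply: cvgMr.
exact: (@cvg_harmonic R).
Qed.

Section FunctionalCalculus.
Variables (R : realType) (H : hilbertType R).
Implicit Types (x y : H) (A B C : bop H) (f g : R -> R) (p q : {poly R}) (e : R).

(** One polynomial per tolerance replaces the sequence and its two limits; the converse picks
    polynomials for the tolerances 1/(k+1). *)
Lemma is_cfcP A f B : is_cfc A f B <-> forall e, 0 < e ->
  exists p, (forall t, spectrum A t%:C -> `|f t - p.[t]| <= e) /\
    forall x, `|bop_horner p A x - B x| <= e%:C * `|x|.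
Proof.
split=> [[p [pf pB]] e e0|pfB].
  have [N pBN] := cvg0_ex pB e0.
  have : nbhs (f : {uniform` [set t : R | spectrum A t%:C] -> R})
      [set h | forall t, spectrum A t%:C -> `|f t - h t| < e].
    apply/uniform_nbhs; exists [set xy : R * R | ball xy.1 (PosNum e0)%:num xy.2].
    by split; first exact: entourage_ball.
  move=> /pf[N' _ pfN]; exists (p (maxn N N')); split.
    by move=> t At; apply/ltW/pfN => //=; exact: leq_maxr.
  move=> x; apply: bop_norm_lt (_ : bop_norm (_ - _) < e).
  by rewrite (le_lt_trans (ler_norm _))// pBN// leq_maxl.
have /choice[p pP] : forall k : nat, exists p,
    (forall t, spectrum A t%:C -> `|f t - p.[t]| <= k.+1%:R^-1) /\
    forall x, `|bop_horner p A x - B x| <= (k.+1%:R^-1)%:C * `|x|.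
  by move=> k; apply: pfB; rewrite invr_gt0 ltr0n.
have h0 := natSinv_cvg0 (1 : R).
exists p; split.
  move=> P /uniform_nbhs [E [entE EP]].
  move: entE; rewrite -entourage_ballE => -[e /= e0 eE].
  have [N hN] := cvg0_ex h0 e0; exists N => // k /= Nk.
  apply: EP => t At; apply: (eE (f t, (p k).[t])) => /=.
  rewrite -ball_normE/= (le_lt_trans ((pP k).1 t At))//.
  by have := hN _ Nk; rewrite mul1r ger0_norm.
apply/cvgr0Pnorm_lt => e e0; have [N hN] := cvg0_ex h0 e0.
exists N => // k /= Nk; have := hN k Nk; rewrite mul1r ger0_norm// => ke.
have k0 : 0 <= k.+1%:R^-1 :> R by [].
have /andP[n0 nk] := bop_norm_le (A := bop_horner (p k) A - B) k0 (pP k).2.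
by rewrite ger0_norm// (le_lt_trans nk).
Qed.

Lemma is_cfc_horner A p : is_cfc A (horner p) (bop_horner p A).
Proof.
apply/is_cfcP => e e0; exists p; split=> [t _|x].
  by rewrite subrr normr0 ltW.
by rewrite subrr normr0 mulr_ge0// ler0c ltW.
Qed.

Lemma is_cfcD A f g B C : is_cfc A f B -> is_cfc A g C ->
  is_cfc A (fun t => f t + g t) (B + C).
Proof.
move=> /is_cfcP fB /is_cfcP gC; apply/is_cfcP => e e0.
have e20 : 0 < e / 2 by rewrite divr_gt0.
have [p [pf pB]] := fB _ e20; have [q [qg qC]] := gC _ e20.
have ee : e = e / 2 + e / 2 by field.
exists (p + q); split=> [t At|x].
  rewrite hornerD opprD addrACA ee (le_trans (ler_normD _ _))// lerD//.
    exact: pf.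
  exact: qg.
rewrite bop_hornerD !bopD opprD addrACA ee rmorphD mulrDl.
by rewrite (le_trans (ler_normD _ _))// lerD.
Qed.

(** Multiplying an e/c-approximation of f by q gives an e-approximation, where c bounds both q on
    the spectrum, contained in [-M, M], and the norm of q(A). *)
Lemma is_cfcMl A f B q : selfadjoint A -> is_cfc A f B ->
  is_cfc A (fun t => q.[t] * f t) (bop_horner q A * B).
Proof.
move=> sA /is_cfcP fB.
have [M M0 AM] := bop_form_bound A.
have [c0 qc0] := poly_disk_bound q M.
have [N N0 qN] := bop_form_bound (bop_horner q A).
pose c := `|c0| + N; have c_gt0 : 0 < c by rewrite ltr_wpDl.
have qc t : spectrum A t%:C -> `|q.[t]| <= c.
  move=> At; rewrite (le_trans (qc0 t _)).
  - by [].
  - rewrite ler_norml (le_spectrum sA _ At)/=; last first.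
      by move=> x; case/andP: (AM x).2.
    by rewrite (ge_spectrum sA _ At)// => x; case/andP: (AM x).2.
  - by rewrite (le_trans (ler_norm _))// lerDl ltW.
apply/is_cfcP => e e0; have ec0 : 0 < e / c by rewrite divr_gt0.
have ecE : e = c * (e / c) by rewrite mulrC divfK// gt_eqF.
have [p [pf pB]] := fB _ ec0; exists (q * p); split=> [t At|x].
  rewrite hornerM -mulrBr normrM [leRHS]ecE ler_pM//; first exact: qc.
  exact: pf.
rewrite bop_hornerM !bop_mul -bop_subr.
rewrite [in leRHS]ecE.
rewrite rmorphM/= -mulrA; apply: le_trans (_ : c%:C * `|bop_horner p A x - B x| <= _).
  rewrite (le_norm_rip _ _ (ltW c_gt0)) (le_trans (qN _).1)// ler_wpM2r ?ripxx_ge0//.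
  by rewrite ler_pXn2r ?nnegrE ?(ltW N0) ?(ltW c_gt0)// lerDr.
by rewrite ler_wpM2l// lecR ltW.
Qed.

Lemma is_cfc_selfadjoint A f B : selfadjoint A -> is_cfc A f B ->
  selfadjoint B.
Proof.
move=> sA /is_cfcP fB; apply/selfadjointP => x y.
apply/eqP; rewrite -subr_eq0 -normr_le0.
apply: (le0_cvg0 (c := rip x x + rip y y) (natSinv_cvg0 (1 : R))) => k.
set e := 1 * _; have e0 : 0 < e by rewrite mulr_gt0.
have [p [_ pB]] := fB e e0.
have sp := selfadjoint_horner p sA.
have := @rip_le_norm _ _ (bop_horner p A - B) e x y e0 (pB x).
have := @rip_le_norm _ _ (bop_horner p A - B) e y x e0 (pB y).
rewrite !bopB !ripDl !ripNl (ripC _ x) ((selfadjointP _).1 sp x y) (ripC (B y) x).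
set u := rip x _; set v := rip x (B y); set w := rip (B x) y => h1 h2.
(* Since p(A) is self-adjoint, the same u approximates both v and w. *)
have -> : w - v = (u - v) - (u - w) by ring.
rewrite (le_trans (ler_normB _ _))//; lra.
Qed.

(** If p is within e of f >= 0, then p + e >= 0 on the spectrum, so p(A) >= -e and B >= -2e for
    every e. *)
Lemma is_cfc_positive A f B : selfadjoint A -> is_cfc A f B ->
  (forall t, spectrum A t%:C -> 0 <= f t) -> positive B.
Proof.
move=> sA AfB f0; apply/positiveP; split; first exact: is_cfc_selfadjoint AfB.
move: AfB => /is_cfcP fB x; rewrite -oppr_le0.
apply: (le0_cvg0 (c := 2 * rip x x) (natSinv_cvg0 (1 : R))) => k.
set e := 1 * _; have e0 : 0 < e by rewrite mulr_gt0.
have [p [pf pB]] := fB e e0.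
have /positiveP[_ /(_ x)] : positive (bop_horner (p + e%:P) A).
  apply: bop_horner_positive => // t At; rewrite hornerD hornerC.
  by have := pf t At; have := f0 t At; rewrite ler_norml => ? /andP[_]; lra.
have := @rip_le_norm _ _ (bop_horner p A - B) e x x e0 (pB x).
rewrite bop_hornerD bop_hornerC !bopE !ripDl !ripNl !ripZl.
set u := rip (bop_horner p A x) x; set v := rip (B x) x => h1 h2.
have : u - v <= `|u - v| by rewrite ler_norm.
lra.
Qed.

(** Weierstrass polynomials p_k with error 1/(k+1) make p_k(A) Cauchy: positivity of 2/(k+1) + (p_l
    - p_k) and 2/(k+1) - (p_l - p_k) at A bounds the form of the difference, hence its norm. *)
Theorem cfcP A f (a b : R) : selfadjoint A -> a <= b ->
  (forall x, a * rip x x <= rip (A x) x <= b * rip x x) ->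
  {within `[a, b], continuous f} -> is_cfc A f (cfc f A).
Proof.
move=> sA ab Aab fc; apply: xgetPex.
have sab t : spectrum A t%:C -> t \in `[a, b].
  move=> At; rewrite in_itv/= (le_spectrum sA _ At)/=.
    by apply: (ge_spectrum sA _ At) => x; case/andP: (Aab x).
  by move=> x; case/andP: (Aab x).
have /choice[p pf] : forall k : nat, exists p,
    {in `[a, b], forall t, `|f t - p.[t]| <= k.+1%:R^-1}.
  by move=> k; apply: weierstrass => //; rewrite invr_gt0 ltr0n.
have [k l x kl|B pB] :=
  bop_complete (T := fun k => bop_horner (p k) A) _ (natSinv_cvg0 (2 : R)).
  rewrite -bopB -bop_hornerB le_norm_rip ?mulr_ge0//.
  have pkl t : spectrum A t%:C ->
      `|(p l - p k).[t]| <= 2 * k.+1%:R^-1.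
    move=> /sab tab; rewrite hornerD hornerN.
    have := pf k t tab; have := pf l t tab.
    have : l.+1%:R^-1 <= k.+1%:R^-1 :> R by rewrite lef_pV2 ?posrE// ler_nat.
    rewrite !ler_norml; move: (l.+1%:R^-1) (k.+1%:R^-1) => u v.
    move=> ? /andP[? ?] /andP[? ?].
    by apply/andP; split; lra.
  apply: selfadjoint_norm_le; first exact: selfadjoint_horner.
    by rewrite mulr_gt0.
  move=> y; set c := 2 * _ in pkl *.
  have /positiveP[_ /(_ y)] : positive (bop_horner (c%:P - (p l - p k)) A).
    apply: bop_horner_positive => // t At; rewrite hornerD hornerN hornerC.
    by have := pkl t At; rewrite ler_norml => /andP[_]; lra.
  have /positiveP[_ /(_ y)] : positive (bop_horner (c%:P + (p l - p k)) A).
    apply: bop_horner_positive => // t At; rewrite hornerD hornerC.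
    by have := pkl t At; rewrite ler_norml => /andP[+ _]; lra.
  rewrite (bop_hornerD c%:P (p l - p k)) (bop_hornerB c%:P) bop_hornerC.
  rewrite bopB (bopD _ (bop_horner _ _)) bopZ bop_one.
  rewrite !ripDl ripNl !ripZl => *; apply/andP; split; lra.
exists B; apply/is_cfcP => e e0.
have [N /(_ N (leqnn N))] := cvg0_ex (natSinv_cvg0 (2 : R)) e0.
rewrite ger0_norm ?mulr_ge0// => Ne; exists (p N); split=> [t /sab tab|x].
  rewrite (le_trans (pf N t tab))// (le_trans _ (ltW Ne))//.
  by rewrite ler_peMl// ler1n.
by rewrite (le_trans (pB N x))// ler_wpM2r// lecR ltW.
Qed.

End FunctionalCalculus.

(** * Derivatives of convex functions *)

Lemma within_itv_continuous (R : realType) (f : R -> R) (a b : R) :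
  (forall x e, x \in `[a, b] -> 0 < e -> exists2 d, 0 < d &
    forall y, y \in `[a, b] -> `|y - x| < d -> `|f y - f x| < e) ->
  {within `[a, b], continuous f}.
Proof.
move=> fc; apply/subspace_continuousP => x xab; apply/cvgrPdist_lt => e e0.
have [d d0 fd] := fc x e xab e0.
apply/nbhs_ballP; exists d => // y xy yab.
rewrite distrC; apply: fd => //; move: xy.
by rewrite -ball_normE/= distrC.
Qed.

Section DerivativeContinuity.
Variable R : realType.
Implicit Types (D : set R) (f g : R -> R).

(** The set D and the slope function g stay abstract so that [derivative_continuous] can pass to
    reflected data. *)
Definition affine_minorant D f g :=
  forall x y, D x -> D y -> f x + g x * (y - x) <= f y.

Definition has_derivative_within D f g := forall x e, D x -> 0 < e ->
  exists2 d, 0 < d & forall y, D y -> `|y - x| < d ->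
    `|f y - f x - g x * (y - x)| <= e * `|y - x|.

(* Near [x] the slope of [f] from [y] to a fixed [z > x] stays below [g x + e],
   and it dominates [g y]. *)
Lemma derivative_lt D f g x e : is_interval D -> affine_minorant D f g ->
  has_derivative_within D f g -> D x -> 0 < e ->
  exists2 d, 0 < d & forall y, D y -> `|y - x| < d -> g y < g x + e.
Proof.
move=> itvD fg dfg Dx e0.
have [[z Dz xz]|/forall2NP Dmax] := pselect (exists2 z, D z & x < z); last first.
  (* Here x is the maximum of D; for y < x the sum of the two minorant inequalities gives g y <= g
     x. *)
  exists 1 => // y Dy _; rewrite ltr_pwDr//.
  have [->//|yx] := eqVneq y x.
  have ylx : y < x.
    by rewrite lt_neqAle yx/= leNgt; apply/negP => xy; case: (Dmax y).
  have := fg x y Dx Dy; have := fg y x Dy Dx => h1 h2.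
  rewrite -(ler_pM2r (_ : 0 < x - y)) ?subr_gt0//; lra.
have e20 : 0 < e / 2 by rewrite divr_gt0.
have [d d0 fd] := dfg x _ Dx e20.
have [d1 d10 fd1] := dfg x _ Dx (@ltr01 R).
pose r := Num.min (z - x) (d / 2).
have r0 : 0 < r by rewrite lt_min subr_gt0 xz divr_gt0.
have rz : r <= z - x by rewrite ge_min lexx.
have rd : r < d.
  by rewrite (@le_lt_trans _ _ (d / 2)) ?ge_min ?lexx ?orbT//; lra.
pose w := x + r.
have Dw : D w by apply: (itvD x z) => //; rewrite /w; apply/andP; split; lra.
have fw : f w - f x <= (g x + e / 2) * r.
  have := fd w Dw; rewrite /w addrAC subrr add0r gtr0_norm// => /(_ rd).
  by rewrite ler_norml => /andP[_]; lra.
(* The slack at the fixed right point w. Replacing x by y changes it by at most C |y - x|, with the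
   1 in C coming from the error term of the derivative. *)
pose h := (g x + e) * r - (f w - f x).
have h0 : 0 < h.
  by rewrite subr_gt0 (le_lt_trans fw)// ltr_pM2r// ltrD2l; lra.
pose C := `|g x + e| + `|g x| + 1.
have C0 : 0 < C by rewrite ltr_wpDl// addr_ge0.
exists (Num.min d1 (Num.min r (h / C))).
  by rewrite lt_min d10 lt_min r0 divr_gt0.
move=> y Dy; rewrite lt_min => /andP[yd1]; rewrite lt_min => /andP[yr yh].
have fy := fd1 y Dy yd1.
have yw : 0 < w - y by move: yr; rewrite /w ltr_norml => /andP[_]; lra.
have gy := fg y w Dy Dw.
rewrite -(ltr_pM2r yw) (@le_lt_trans _ _ (f w - f y))//; first lra.
rewrite -subr_gt0.
have -> : (g x + e) * (w - y) - (f w - f y) =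
  h + ((f y - f x - g x * (y - x)) + (g x * (y - x) - (g x + e) * (y - x))).
  by rewrite /h /w; ring.
rewrite -ltrBlDl sub0r ltrNl (le_lt_trans (ler_norm _))// normrN.
have : `|y - x| * C < h by rewrite -ltr_pdivlMr.
apply: le_lt_trans; rewrite (le_trans (ler_normD _ _))//.
rewrite [leRHS]mulrDr [leRHS]addrC lerD//; first by rewrite mulr1 (le_trans fy)// mul1r.
rewrite [leRHS]mulrDr [leRHS]addrC (le_trans (ler_normB _ _))// lerD//.
  by rewrite normrM mulrC.
by rewrite normrM mulrC.
Qed.

(** [derivative_lt] bounds g from above near x; applied to f(-y), whose slope function is -g(-y), it
    bounds g from below. *)
Lemma derivative_continuous D f g x e : is_interval D ->
  affine_minorant D f g -> has_derivative_within D f g -> D x -> 0 < e ->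
  exists2 d, 0 < d & forall y, D y -> `|y - x| < d -> `|g y - g x| < e.
Proof.
move=> itvD fg dfg Dx e0.
have [d1 d10 gd1] := derivative_lt itvD fg dfg Dx e0.
pose D' := [set y | D (- y)]; pose f' := f \o -%R; pose g' y := - g (- y).
have itvD' : is_interval D'.
  move=> u v Du Dv w /andP[uw wv]; apply: (itvD (- v) (- u)) => //.
  by rewrite !lerN2 wv.
have fg' : affine_minorant D' f' g'.
  move=> u v Du Dv; have := fg _ _ Du Dv; rewrite /f' /g' /=; lra.
have dfg' : has_derivative_within D' f' g'.
  move=> u r Du r0; have [d d0 fd] := dfg _ _ Du r0.
  exists d => // v Dv uv; have := fd _ Dv.
  rewrite -opprD normrN => /(_ uv); rewrite /f' /g' /=.
  by rewrite mulNr mulrN.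
have Dx' : D' (- x) by rewrite /D'/= opprK.
have [d2 d20 gd2] := derivative_lt itvD' fg' dfg' Dx' e0.
exists (Num.min d1 d2); first by rewrite lt_min d10.
move=> y Dy; rewrite lt_min => /andP[yd1 yd2].
have := gd1 y Dy yd1; have := gd2 (- y); rewrite /D' /g' /= -opprD normrN !opprK.
by move=> /(_ Dy yd2) ? ?; rewrite ltr_norml; apply/andP; split; lra.
Qed.

End DerivativeContinuity.

Section ConvexDerivative.
Variables (R : realType) (J : interval R) (f : R -> R).
Hypothesis fJ : C1co J f.

Lemma C1co_has_derivative :
  has_derivative_within [set` J] f (derive_in J f).
Proof.
move=> x e xJ e0; have := fJ.1 x xJ.
move=> /cvgrPdist_lt/(_ _ e0)/nbhs_ballP[d /= d0 fd].
exists d => // y yJ yx; have [->|ynx] := eqVneq y x.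
  by rewrite !subrr mulr0 subrr normr0 mulr0.
have := fd y; rewrite -ball_normE/= distrC => /(_ yx ynx yJ).
rewrite -/(derive_in J f x) /diff_quotient => h.
have yx0 : y - x != 0 by rewrite subr_eq0.
have -> : f y - f x - derive_in J f x * (y - x) =
   - (derive_in J f x - (f y - f x) / (y - x)) * (y - x) by field.
by rewrite normrM normrN ler_wpM2r// ltW.
Qed.

Lemma C1co_convex x y (s : R) : x \in J -> y \in J -> 0 <= s <= 1 ->
  f (x + s * (y - x)) <= f x + s * (f y - f x).
Proof.
move=> xJ yJ /andP[s0 s1].
have := fJ.2 (Itv01 s0 s1) y x.
rewrite !inE convRE => /(_ yJ xJ) /=.
have -> : x + s * (y - x) = s * y + (1 - s) * x by ring.
by move=> /le_trans; apply; rewrite /unstable.onem; lra.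
Qed.

(** If f(y) lay below the tangent at x by q > 0, convexity would keep f(x + s(y - x)) below it by at
    least sq, which is not o(s). *)
Lemma C1co_affine_minorant : affine_minorant [set` J] f (derive_in J f).
Proof.
move=> x y xJ yJ; rewrite leNgt; apply/negP => fxy.
set L := derive_in J f x in fxy.
have ynx : y - x != 0.
  by apply: contraTneq fxy => /subr0_eq ->; rewrite subrr mulr0 addr0 ltxx.
have yx0 : 0 < `|y - x| by rewrite normr_gt0.
pose q := L * (y - x) - (f y - f x); have q0 : 0 < q by rewrite /q; lra.
(* With this e the derivative error at x + s(y - x) is at most sq / 2. *)
pose e := q / 2 / `|y - x|; have e0 : 0 < e by rewrite !divr_gt0.
have [d d0 fd] := C1co_has_derivative xJ e0.
pose s := Num.min 1 (d / 2 / `|y - x|).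
have s0 : 0 < s by rewrite lt_min ltr01 !divr_gt0.
have s1 : s <= 1 by rewrite ge_min lexx.
have s01 : 0 <= s <= 1 by rewrite ltW.
have sd : s * `|y - x| < d.
  rewrite (@le_lt_trans _ _ (d / 2))//; last lra.
  by rewrite -ler_pdivlMr// ge_min lexx orbT.
have fz := C1co_convex xJ yJ s01.
have zJ : x + s * (y - x) \in J.
  have [xy|yx] := leP x y.
    by apply: (interval_is_interval xJ yJ); apply/andP; split; nra.
  by apply: (interval_is_interval yJ xJ); apply/andP; split; nra.
have := fd _ zJ; rewrite addrAC subrr add0r normrM gtr0_norm// => /(_ sd).
have -> : e * (s * `|y - x|) = s * (q / 2) by rewrite mulrCA /e divfK ?gt_eqF.
have sq0 : 0 < s * q by rewrite mulr_gt0.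
rewrite -/L ler_norml => /andP[+ _]; rewrite /q in sq0 *; nra.
Qed.

Lemma C1co_continuous x e : x \in J -> 0 < e -> exists2 d, 0 < d &
  forall y, y \in J -> `|y - x| < d -> `|f y - f x| < e.
Proof.
move=> xJ e0; have [d d0 fd] := C1co_has_derivative xJ (@ltr01 R).
set L := derive_in J f x in fd.
have L0 : 0 < 1 + `|L| by rewrite ltr_wpDr.
exists (Num.min d (e / (1 + `|L|))); first by rewrite lt_min d0 divr_gt0.
move=> y yJ; rewrite lt_min ltr_pdivlMr// => /andP[/(fd y yJ) fy ye].
rewrite -[f y - f x](subrK (L * (y - x))) (le_lt_trans (ler_normD _ _))//.
rewrite normrM (le_lt_trans _ ye)// [leRHS]mulrDr mulr1 lerD//; first by rewrite -[leRHS]mul1r.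
by rewrite mulrC.
Qed.

Lemma C1co_itv_continuous a b : a \in J -> b \in J ->
  {within `[a, b], continuous f} /\ {within `[a, b], continuous (derive_in J f)}.
Proof.
move=> aJ bJ.
have abJ x : x \in `[a, b] -> x \in J.
  by rewrite in_itv/=; apply: interval_is_interval.
split; apply: within_itv_continuous => x e /abJ xJ e0.
  have [d d0 fd] := C1co_continuous xJ e0.
  by exists d => // y /abJ; exact: fd.
have [d d0 fd] := derivative_continuous (@interval_is_interval _ J)
  C1co_affine_minorant C1co_has_derivative xJ e0.
by exists d => // y /abJ; exact: fd.
Qed.

End ConvexDerivative.

(** * Unital families of positive maps *)

Section UnitalPositiveFamily.
Variables (R : realType) (H K : hilbertType R) (n : nat).
Variable Phi : 'I_n -> {linear bop H -> bop K}.
Hypothesis Phi_pos : forall i, positive_map (Phi i).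
Hypothesis Phi_unital : \sum_(i < n) Phi i 1 = 1.
Implicit Types (A B : 'I_n -> bop H).

Lemma sum_positive_map B : (forall i, positive (B i)) ->
  positive (\sum_(i < n) Phi i (B i)).
Proof. by move=> pB; apply: positive_sum => i; apply: Phi_pos. Qed.

(** Unitality enters here: multiples of the identity on H sum to the same multiples on K. *)
Lemma sum_Phi_affine A B (c d : R[i]) :
  \sum_(i < n) Phi i (B i + (c *: (1 : bop H) + d *: A i)) =
  \sum_(i < n) Phi i (B i) +
    (c *: (1 : bop K) + d *: \sum_(i < n) Phi i (A i)).
Proof.
rewrite -Phi_unital !scaler_sumr -!big_split/=; apply: eq_bigr => i _.
by rewrite linearD linearD !linearZ.
Qed.

(** A zero space H or an empty family would force 1 = 0 on K. This secures spectral values of each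
    A_i and extrema over the index set. *)
Lemma unital_nontrivial : (exists x : K, x != 0) ->
  (exists y : H, y != 0) /\ (0 < n)%N.
Proof.
move=> [x /eqP x0]; split.
  apply: contrapT => /forallNP H0; apply: x0.
  have one0 : (1 : bop H) = 0.
    by apply: bop_ext => y; have /negP/negPn/eqP -> := H0 y.
  have : (1 : bop K) = 0.
    by rewrite -Phi_unital big1// => i _; rewrite one0 linear0.
  by move=> /(congr1 (fun B : bop K => B x)).
rewrite lt0n; apply/eqP => n0; apply: x0.
have : (1 : bop K) = 0.
  by rewrite -Phi_unital big1// => i; have := ltn_ord i; rewrite [X in (_ < X)%N]n0.
by move=> /(congr1 (fun B : bop K => B x)).
Qed.

(** Positivity of the maps is applied to A_i - a and b - A_i; S is self-adjoint because S - a is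
    positive. *)
Lemma sum_Phi_form_bounds A (a b : R) :
  (forall i y, a * rip y y <= rip (A i y) y <= b * rip y y) ->
  (forall i, selfadjoint (A i)) ->
  let S := \sum_(i < n) Phi i (A i) in
  selfadjoint S /\ forall x, a * rip x x <= rip (S x) x <= b * rip x x.
Proof.
move=> Aab sA S.
have Phi0 : \sum_(i < n) Phi i 0 = 0 by apply: big1 => i _; rewrite linear0.
have pa : positive (S - a%:C *: (1 : bop K)).
  have -> : S - a%:C *: (1 : bop K) =
      \sum_(i < n) Phi i (0 + ((- a%:C) *: (1 : bop H) + 1 *: A i)).
    by rewrite (sum_Phi_affine A (fun=> 0)) Phi0 add0r scale1r scaleNr addrC.
  apply: sum_positive_map => i; rewrite add0r scale1r -rmorphN.
  apply/positiveP; split; first exact/selfadjointD/(sA i)/selfadjointZ.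
  move=> y; rewrite bopD ripDl bopZR bop_one.
  by have /andP[+ _] := Aab i y; lra.
have pb : positive (b%:C *: (1 : bop K) - S).
  have -> : b%:C *: (1 : bop K) - S =
      \sum_(i < n) Phi i (0 + (b%:C *: (1 : bop H) + (-1) *: A i)).
    by rewrite (sum_Phi_affine A (fun=> 0)) Phi0 add0r scaleN1r.
  apply: sum_positive_map => i; rewrite add0r scaleN1r.
  apply/positiveP; split; first exact/selfadjointB/(sA i)/selfadjointZ.
  move=> y; rewrite bopB ripDl ripNl bopZR bop_one.
  by have /andP[_] := Aab i y; lra.
have /positiveP[sSa Sa] := pa; have /positiveP[_ Sb] := pb.
split.
  rewrite -[S](subrK (a%:C *: (1 : bop K))).
  by apply: selfadjointD => //; apply/selfadjointZ/selfadjoint1.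
move=> x; have := Sa x; have := Sb x.
rewrite !bopB !ripDl !ripNl !bopZR bop_one => *.
by apply/andP; split; lra.
Qed.

End UnitalPositiveFamily.

(** * The operator inequality with the defect term [eta] *)

Theorem corollary2p2 (R : realType) (H K : hilbertType R) (n : nat)
    (Phi : 'I_n -> {linear bop H -> bop K})
    (Phi_pos : forall i, positive_map (Phi i))
    (Phi_unital : \sum_(i < n) Phi i 1 = 1)
    (J : interval R) (A : 'I_n -> bop H)
    (A_sa : forall i, selfadjoint (A i))
    (A_spec : forall i, spectrum (A i) `<=` [set t%:C | t in [set` J]])
    (f : R -> R) (f_C1co : C1co J f) :
  let S : bop K := \sum_(i < n) Phi i (A i) in
  let f'S : bop K := cfc (derive_in J f) S in
  let eta : R :=
    sup [set complex.Re ('<<(f'S * S) x, x>> - '<<S x, x>> * '<<f'S x, x>>)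
        | x in [set x : K | `|x| = 1]] in
  bop_le (cfc f S) (\sum_(i < n) Phi i (cfc f (A i)) + eta%:C *: (1 : bop K)).
Proof.
move=> S f'S eta; rewrite /bop_le; set F := \sum_(i < n) Phi i (cfc _ _).
have [K0|/forallNP K0] := pselect (exists x : K, x != 0); last first.
  by move=> x; have /negP/negPn/eqP -> := K0 x; rewrite linear0.
have [H0 n0] := unital_nontrivial Phi_unital K0.
have specJ i (t : R) : spectrum (A i) t%:C -> t \in J.
  by move=> /A_spec[u uJ /complexI <-].
have /choice[m mP] : forall i, exists m, m \in J /\
    forall y, m * rip y y <= rip (A i y) y.
  by move=> i; have [m /specJ mJ mA] := inf_spectrum H0 (A_sa i); exists m.
have /choice[M MP] : forall i, exists M, M \in J /\
    forall y, rip (A i y) y <= M * rip y y.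
  by move=> i; have [M /specJ MJ MA] := sup_spectrum H0 (A_sa i); exists M.
(* The least of the finitely many m_i is itself a spectral value, so a stays in J even when J is
   open or unbounded. *)
have [a aJ am] : exists2 a, a \in J & forall i, a <= m i.
  case: (@arg_minP _ _ _ (Ordinal n0) xpredT m) => // i _ mi.
  by exists (m i); [exact: (mP i).1|move=> j; exact: mi].
have [b bJ bM] : exists2 b, b \in J & forall i, M i <= b.
  case: (@arg_maxP _ _ _ (Ordinal n0) xpredT M) => // i _ Mi.
  by exists (M i); [exact: (MP i).1|move=> j; exact: Mi].
have Aab i y : a * rip y y <= rip (A i y) y <= b * rip y y.
  rewrite (le_trans _ ((mP i).2 y)) ?(le_trans ((MP i).2 y))//;
  by rewrite ler_wpM2r ?ripxx_ge0.
have [sS Sab] := sum_Phi_form_bounds Phi_pos Phi_unital Aab A_sa.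
rewrite -/S in sS Sab.
have rip_gt0 (x : K) : x != 0 -> 0 < rip x x.
  move=> x0; rewrite lt_def ripxx_ge0 andbT.
  by apply: contra x0 => /eqP/rip_eq0 ->.
have ab : a <= b.
  have [x /rip_gt0 x0] := K0; have /andP[Sa Sb] := Sab x.
  by rewrite -(ler_pM2r x0) (le_trans Sa).
have [fc f'c] := C1co_itv_continuous f_C1co aJ bJ.
have grad := C1co_affine_minorant f_C1co.
have abJ (t : R) : a <= t <= b -> t \in J by exact: interval_is_interval.
have specS (t : R) : spectrum S t%:C -> t \in J.
  move=> St; apply: abJ; rewrite (le_spectrum sS _ St)/=.
    by apply: (ge_spectrum sS _ St) => x; case/andP: (Sab x).
  by move=> x; case/andP: (Sab x).
have cA i : is_cfc (A i) f (cfc f (A i)) by exact: cfcP (A_sa i) ab (Aab i) fc.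
have cS : is_cfc S f (cfc f S) by exact: cfcP sS ab Sab fc.
have c'S : is_cfc S (derive_in J f) f'S by exact: cfcP sS ab Sab f'c.
have sf'S := is_cfc_selfadjoint sS c'S.
have sfS := is_cfc_selfadjoint sS cS.
(* The operator added to F is minus the tangent line of f at s, evaluated at S. *)
have pF s : s \in J -> positive (F + ((derive_in J f s * s - f s)%:C *: (1 : bop K)
    + (- derive_in J f s)%:C *: S)).
  move=> sJ; rewrite -sum_Phi_affine//; apply: sum_positive_map => // i.
  set c := derive_in J f s * s - f s; set d := - derive_in J f s.
  have := is_cfcD (cA i) (is_cfc_horner (A i) (c%:P + d%:P * 'X)).
  rewrite bop_hornerD bop_hornerM !bop_hornerC bop_hornerX bopZMl mul1r.
  move=> /(is_cfc_positive (A_sa i)); apply => t /specJ tJ.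
  have := grad s t sJ tJ; rewrite hornerD hornerM !hornerC hornerX /c /d; lra.
(* F differs from a positive operator by a self-adjoint affine expression in S. *)
have sF : selfadjoint F.
  have := positive_selfadjoint (pF a aJ) => sF0.
  rewrite -[F](addrK ((derive_in J f a * a - f a)%:C *: (1 : bop K)
    + (- derive_in J f a)%:C *: S)).
  by apply: selfadjointB => //; apply: selfadjointD; apply: selfadjointZ => //.
have unit_le (u : K) : rip u u = 1 ->
    0 <= rip ((F + eta%:C *: (1 : bop K) - cfc f S) u) u.
  move=> u1; set s := rip (S u) u.
  have sJ : s \in J by have := Sab u; rewrite u1 !mulr1; exact: abJ.
  have /positiveP[_ /(_ u)] := pF s sJ.
  set f's := derive_in J f s.
  rewrite !bopD !ripDl !bopZR bop_one u1 -/s => Fs.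
  (* The function f(s) - f(t) + (t - s) f'(t) is nonnegative: the tangent at t lies below f at s.
     The factors -1 and t - s are polynomials, as [is_cfcMl] requires. *)
  have /(is_cfc_positive sS) := is_cfcD (is_cfc_horner S (f s)%:P)
    (is_cfcD (is_cfcMl (-1)%:P sS cS) (is_cfcMl ('X - s%:P) sS c'S)).
  have /[swap]/[apply] : forall t : R, spectrum S t%:C ->
      0 <= (f s)%:P.[t] + ((-1)%:P.[t] * f t +
        ('X - s%:P).[t] * derive_in J f t).
    move=> t /specS tJ; have := grad t s tJ sJ.
    by rewrite hornerXsubC !hornerC; lra.
  rewrite bop_hornerB !bop_hornerC bop_hornerX mulrBl !bopZMl !mul1r.
  move=> /positiveP[_ /(_ u)].
  rewrite !bopD !bopN !ripDl !ripNl !bopZR bop_one bop_mul u1.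
  (* Self-adjointness of both factors turns the form of S f'(S) into that of f'(S) S, the order used
     in [eta]. *)
  rewrite ((selfadjointP S).1 sS) ((selfadjointP f'S).1 sf'S) -bop_mul (ripC u ((f'S * S) u)).
  move=> fs.
  suff : rip ((f'S * S) u) u - s * rip (f'S u) u <= eta.
    lra.
  (* The supremum dominates its set once the set is bounded above; form bounds for f'(S)S, S and
     f'(S) on unit vectors give M1 + M2 M3. *)
  apply: ub_le_sup.
    have [M1 _ S1] := bop_form_bound (f'S * S).
    have [M2 M20 S2] := bop_form_bound S.
    have [M3 M30 S3] := bop_form_bound f'S.
    exists (M1 + M2 * M3) => _ [v /= v1 <-].
    have vv : rip v v = 1.
      apply: complexI; rewrite -innerxx innerE v1 expr1n.
      by rewrite rmorph1.
    rewrite ReB (selfadjoint_inner v sS) (selfadjoint_inner v sf'S) ReZ.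
    have := S1 v; have := S2 v; have := S3 v; rewrite vv !mulr1.
    move=> [_ h3] [_ h2] [_ /andP[_ h1]].
    rewrite -/(rip _ _) lerD// (le_trans (ler_norm _))// normrN normrM.
    by rewrite ler_pM// ler_norml.
  exists u; first by rewrite /= norm_rip u1 sqrtr1.
  rewrite ReB (selfadjoint_inner u sS) (selfadjoint_inner u sf'S). by rewrite ReZ.
apply/positiveP; split.
  apply: selfadjointB => //; apply: selfadjointD => //.
  exact/selfadjointZ/selfadjoint1.
move=> x; have [->|x0] := eqVneq x 0; first by rewrite linear0 rip0l.
have xx0 := rip_gt0 x x0.
pose r := Num.sqrt (rip x x); have r0 : 0 < r by rewrite sqrtr_gt0.
have xE : x = r%:C *: ((r^-1)%:C *: x).
  by rewrite scalerA -rmorphM/= divff ?gt_eqF// scale1r.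
rewrite xE linearZ ripZl ripZr !mulr_ge0 ?(ltW r0)//; apply: unit_le.
rewrite ripZl ripZr mulrA -expr2 exprVn sqr_sqrtr ?ltW// mulVf//.
by rewrite gt_eqF.
Qed.
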